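(* Let $X(t),t\in\mathbb{Z}^d$, be a stationary max-stable rf with unit Fréchet marginals, spectral rf $Z$, spectral tail rf $\Theta$, and $Y=R\Theta$. Let $\mathcal I$ be an anchoring map with $P(\mathcal I(Y)\in\mathbb{Z}^d,\mathcal S(Y)<\infty)=P(\mathcal S(Y)<\infty)$. If $P(\mathcal S(\Theta)<\infty)>0$, then $$\theta_X=P(\mathcal I(Y)=0,\mathcal S(Y)<\infty)=P(\mathcal I_{fe}(Y)=0)=P(\mathcal I_A(\Theta)=0)=E\Big[\frac{\max_t\Theta(t)}{\sum_t\Theta(t)}\Big]=E\Big[Z(0)\frac{\max_tZ(t)}{\sum_tZ(t)}\Big]=E\Big[\frac1{\mathcal B(Y)}\Big],$$ and if moreover $\mathcal I$ is $0$-homogeneous then also $\theta_X=P(\mathcal I(\Theta)=0,\mathcal S(\Theta)<\infty)$. Furthermore, $\{\mathcal B(Y)<\infty\}=\{\mathcal S(Y)<\infty\}$ almost surely, and $\theta_X=1$ if and only if $\Theta(i)=0$ almost surely for every $i\in\mathbb{Z}^d\setminus\{0\}$. (The identity $\theta_X=E[1/\mathcal B(Y)]$ holds also without the assumption $P(\mathcal S(\Theta)<\infty)>0$.)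
   Context: $E=[0,\infty)^{\mathbb{Z}^d}$ with product $\sigma$-field; shift $(B^hf)(t)=f(t-h)$; $\mathcal S(f)=\sum_{t}f(t)$, $\mathcal B(f)=\sum_t\mathbf 1(f(t)>1)$; ratios $0/0$ and $\infty/\infty$ (and $c/\infty$) are interpreted as $0$, and $1/\infty=0$. A max-stable rf $X$ with unit Fréchet marginals has a spectral rf $Z$: non-negative, $E Z(t)=1$, $P(\sup_tZ(t)>0)=1$, with $-\ln P(X(t_i)\le x_i,i\le n)=E[\max_{i\le n}Z(t_i)/x_i]$. Its spectral tail rf $\Theta$ is given by $P(\Theta\in A)=E[Z(0)\mathbf 1(Z/Z(0)\in A)]$ ($\Theta(0)=1$ a.s.); $Y=R\Theta$ with $R$ unit Pareto ($P(R>x)=1/x$, $x\ge1$) independent of $\Theta$. Extremal index: $\theta_X=\lim_n n^{-d}E[\max_{t\in[0,n]^d\cap\mathbb{Z}^d}Z(t)]\in[0,1]$. Fix a translation-invariant total order on $\mathbb{Z}^d$ (minima below are with respect to it). An anchoring map is a measurable $\mathcal I:E\to\mathbb{Z}^d\cup\{\infty\}$ such that for all $f$ with $\mathcal I(f)\in\mathbb{Z}^d$ and all $i$: (i) $\mathcal I(f)=i$ implies $f(i)\ge\min(f(0),1)$; (ii) $\mathcal I(f)=\mathcal I(B^if)-i$. First maximum functional: $\mathcal I_A(f)=\min\{j:f(j)=\max_if(i)\}$ if $\mathcal S(f)<\infty$ and $\max_if(i)>0$, and $\mathcal I_A(f)=\infty$ otherwise. First exceedance functional: $\mathcal I_{fe}(f)=\min\{j:f(j)>1\}$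 if $\mathcal S(f)<\infty$ and $\max_if(i)>1$, and $\infty$ otherwise. $\mathcal I$ is 0-homogeneous if $\mathcal I(cf)=\mathcal I(f)$ for $c>0$. *)

(* Defs.v *)
From HB Require Import structures.
From mathcomp Require Import all_boot all_order all_algebra.
From mathcomp Require Import all_classical all_reals all_analysis.
Set Implicit Arguments. Unset Strict Implicit. Unset Printing Implicit Defensive.
Import Order.TTheory GRing.Theory Num.Theory.
Local Open Scope classical_set_scope.
Local Open Scope ring_scope.

Definition Zd (d : nat) := {ffun 'I_d -> int}.

Section Defs.
Context {R : realType} {d : nat}.

Definition inE (f : Zd d -> R) : Prop := forall t, 0 <= f t.

Definition Bshift (h : Zd d) (f : Zd d -> R) : Zd d -> R := fun t => f (t - h).

Definition cylinders : set (set (Zd d -> R)) :=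
  [set A | exists (t : Zd d) (B : set R), measurable B /\ A = [set f | B (f t)]].
Definition prodF : set (set (Zd d -> R)) := <<s cylinders >>.

Definition SS (f : Zd d -> R) : \bar R := (\esum_(t in [set: Zd d]) (f t)%:E)%E.
Definition BB (f : Zd d -> R) : \bar R :=
  (\esum_(t in [set: Zd d]) (if 1 < f t then 1 else 0 : R)%:E)%E.
Definition supf (f : Zd d -> R) : \bar R := ereal_sup [set (f t)%:E | t in [set: Zd d]].

(* ratio with the conventions 0/0 = 0, c/oo = 0 (in particular oo/oo = 0, 1/oo = 0) *)
Definition ediv (a b : \bar R) : \bar R :=
  match b with
  | r%:E => if r == 0 then 0%E else (a * (r^-1)%:E)%E
  | _ => 0%E
  end.

Definition ti_total_order (ord : rel (Zd d)) : Prop :=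
  [/\ reflexive ord, antisymmetric ord, transitive ord, total ord &
      forall x y h, ord x y = ord (x + h) (y + h)].

(* the minimum of a set w.r.t. ord (used only for nonempty finite sets) *)
Definition minset (ord : rel (Zd d)) (M : set (Zd d)) : Zd d :=
  xget 0 [set j | M j /\ forall k, M k -> ord j k].

(* first maximum functional I_A; None encodes the value oo *)
Definition I_A (ord : rel (Zd d)) (f : Zd d -> R) : option (Zd d) :=
  if pselect ((SS f < +oo)%E /\ (0 < supf f)%E)
  then Some (minset ord [set j | (f j)%:E = supf f]) else None.

Definition I_fe (ord : rel (Zd d)) (f : Zd d -> R) : option (Zd d) :=
  if pselect ((SS f < +oo)%E /\ (1 < supf f)%E)
  then Some (minset ord [set j | 1 < f j]) else None.

(* anchoring map (None encodes oo) *)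
Definition anchoring (I : (Zd d -> R) -> option (Zd d)) : Prop :=
  (forall j : option (Zd d), prodF (I @^-1` [set j])) /\
  (forall f, inE f -> I f <> None ->
     (forall i, I f = Some i -> Num.min (f 0) 1 <= f i) /\
     (forall i, I f = omap (fun k => k - i) (I (Bshift i f)))).

Definition zero_homogeneous (I : (Zd d -> R) -> option (Zd d)) : Prop :=
  forall f (c : R), inE f -> 0 < c -> I (fun t => c * f t) = I f.

Definition box (n : nat) : set (Zd d) :=
  [set t | forall k, 0 <= t k /\ t k <= n%:Z].

Definition extremal_index_is {dT : measure_display} {T : measurableType dT}
  (P : probability T R) (Z : T -> Zd d -> R) (th : \bar R) : Prop :=
  (fun n : nat => ((n%:R ^- d)%:E *
      \int[P]_w ereal_sup [set (Z w t)%:E | t in box n])%E) @ \oo --> th.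

End Defs.

(* Main.v *)
Require Import Defs.
From HB Require Import structures.
From mathcomp Require Import all_boot all_order all_algebra.
From mathcomp Require Import all_classical all_reals all_analysis.
Import Order.TTheory GRing.Theory Num.Theory.
Local Open Scope classical_set_scope.
Local Open Scope ring_scope.
From mathcomp Require Import measurable_realfun ring lra zify.
Import numFieldNormedType.Exports.
Set Implicit Arguments.
Unset Strict Implicit.
Unset Printing Implicit Defensive.

(* Write V(s) = E[max_{(t,x) in s} Z(t)/x]. Integrating out the Pareto variable
   gives P(Y(t_i) <= x_i for all i) = V((0,1), s) - V(s), and V is shift invariant
   because it is minus the logarithm of a distribution function of X. Expanding
   both sides, this yields the time-change formula
     P(Y in A, Y(h) > 1) = P(B^h Y in A, Y(-h) > 1),
   a mass-transport principle for the exceedance points of Y: if a functional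
   selects exactly one exceedance of every configuration with finitely many of
   them, the probability that it selects 0 is E[1/B(Y)]. All anchoring maps are
   of this kind. Transporting mass to the first maximum, which is 0-homogeneous,
   and integrating out the Pareto variable turns B(Y) into S(Theta); this shows
   that B(Y) < oo implies S(Y) < oo and gives the formula with max / sum.
   Finally E[max_box Z] telescopes, in the given order on Z^d, into the sum over t
   in the box of the probabilities that Y has no exceedance at the points u - t
   with u < t in the box, and all but a boundary proportion of these are close to
   the probability that 0 is the first exceedance of Y. *)

(** * Countable families and the product space *)

(** A selector cannot act on configurations with infinitely many exceedances: the origin would send
    infinite expected mass, yet it receives at most 1. The same comparison, with the indicator of S
    = oo as weight and the first maximum as selector, is what rules out S(Y) = oo when B(Y) < oo.
    The first maximum is suited to the passage to Theta for a second reason. If the origin is the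
    maximum and Theta(0) = 1, then every Theta(t) <= 1, so the conditional probability min(Theta(t),
    1) of Y(t) > 1 given Theta is Theta(t) itself, and summing over t gives S(Theta). Two gaps shape
    the details. An anchoring map only guarantees a value >= 1 at the anchor while exceedances are
    strict, so P(Y(t) = 1) = 0 has to be proved. And the path space contains fields with negative
    values, while the functionals behave well on nonnegative ones; hence the truncations at 0 in
    auxiliary functionals and the separate treatment of Rp < 0. *)

Section CountableIndex.
Context {R : realType} {I : countType} {d : measure_display}.
Context {T : measurableType d}.
Local Open Scope ereal_scope.

(** Sites are enumerated by their codes, and a number that codes no site contributes 0. This makes
    the theorems on series of functions available for sums over [Zd d]. *)
Lemma esum_nneseries (a : I -> \bar R) : (forall t, 0 <= a t) ->
  \esum_(t in [set: I]) a t = \sum_(0 <= n <oo) oapp a 0 (pickle_inv n).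
Proof.
move=> a0; rewrite nneseries_esumT; last by move=> n; case: pickle_inv => /=.
have -> : \esum_(t in [set: I]) a t =
    \esum_(t in [set: I]) oapp a 0 (pickle_inv (pickle t)).
  by apply: eq_esum => t _; rewrite pickleK_inv.
rewrite -(esum_image [set: I] pickle (fun n => oapp a 0 (pickle_inv n))).
  rewrite esum_mkcond; apply: eq_esum => n _; case: ifPn => //.
  case E: (pickle_inv n) => [t|//] /negP[]; rewrite inE; exists t => //.
  by have := @pickle_invK I n; rewrite E.
by move=> s t _ _ /(congr1 (@pickle_inv I)); rewrite !pickleK_inv => -[].
Qed.

Lemma measurable_esum (f : I -> T -> \bar R) :
  (forall t, measurable_fun setT (f t)) -> (forall t x, 0 <= f t x) ->
  measurable_fun setT (fun x => \esum_(t in [set: I]) f t x).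
Proof.
move=> mf f0.
under eq_fun do rewrite esum_nneseries//.
apply: (@ge0_emeasurable_sum _ _ _ _
  (fun n x => oapp (f^~ x) 0 (pickle_inv n)) xpredT).
  by move=> n x _ _; case: pickle_inv => /=.
by move=> n _; case: pickle_inv => //= t; exact: mf.
Qed.

Lemma integral_esum (mu : {measure set T -> \bar R}) (f : I -> T -> \bar R) :
  (forall t, measurable_fun setT (f t)) -> (forall t x, 0 <= f t x) ->
  \int[mu]_x (\esum_(t in [set: I]) f t x) =
  \esum_(t in [set: I]) \int[mu]_x f t x.
Proof.
move=> mf f0.
under eq_integral do rewrite esum_nneseries//.
rewrite integral_nneseries//; last 2 first.
- by move=> n; case: pickle_inv => //= t; exact: mf.
- by move=> n x _; case: pickle_inv => /=.
rewrite esum_nneseries; last by move=> t; exact: integral_ge0.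
apply: eq_eseriesr => n _; case: pickle_inv => //=.
by rewrite integral0.
Qed.

Lemma measurable_bigcup_countable (D : set I) (A : I -> set T) :
  (forall t, D t -> measurable (A t)) -> measurable (\bigcup_(t in D) A t).
Proof.
move=> mA; rewrite bigcup_mkcond; apply: countable_bigcupT_measurable => // t.
by case: ifPn => //; rewrite inE; exact: mA.
Qed.

Lemma measurable_bigcap_countable (D : set I) (A : I -> set T) :
  (forall t, D t -> measurable (A t)) -> measurable (\bigcap_(t in D) A t).
Proof.
move=> mA; rewrite -[X in measurable X]setCK setC_bigcap; apply: measurableC.
by apply: measurable_bigcup_countable => t /mA; exact: measurableC.
Qed.

Lemma measurable_ereal_sup (f : I -> T -> \bar R) :
  (forall t, measurable_fun setT (f t)) ->
  measurable_fun setT (fun x => ereal_sup [set f t x | t in [set: I]]).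
Proof.
move=> mf; apply: (measurability _ (ErealGenOInfty.measurableE R)).
move=> /= _ [_ [x ->]] <-; rewrite setTI.
rewrite (_ : _ @^-1` _ = \bigcup_t (f t @^-1` `]x%:E, +oo[)).
  apply: measurable_bigcup_countable => t _; rewrite -[X in measurable X]setTI.
  by apply: mf => //; exact: emeasurable_itv.
apply/seteqP; split => y /=; rewrite in_itv/= andbT.
  by move=> /ereal_sup_gt[_ [t _ <-]] xt; exists t => //=; rewrite in_itv/= xt.
move=> [t _] /=; rewrite in_itv/= andbT => /lt_le_trans; apply.
by apply: ereal_sup_ubound; exists t.
Qed.

End CountableIndex.

(** On this type [measurable] unfolds to [prodF], so hypotheses stated with [prodF] apply directly
    to its measurable sets. *)
Notation fieldspace R d := (g_sigma_algebraType (@cylinders R d)).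

Section FieldSpace.
Context {R : realType} {d : nat}.
Local Notation E := (fieldspace R d).

Lemma measurable_coord (t : Zd d) : measurable_fun setT (fun f : E => (f t : R)).
Proof.
move=> _ B mB; rewrite setTI; apply: sub_sigma_algebra.
by exists t, B.
Qed.

Lemma measurable_field {dT : measure_display} {T : measurableType dT}
    (F : T -> E) :
  (forall t, measurable_fun setT (fun w => F w t : R)) -> measurable_fun setT F.
Proof.
move=> mF; apply: (@measurability _ _ T E setT F (@cylinders R d)).
  by [].
move=> /= _ [_ [t [B [mB ->]]]] <-.
exact: mF.
Qed.

Lemma measurable_Bshift (h : Zd d) : measurable_fun setT (Bshift h : E -> E).
Proof. by apply: measurable_field => t; exact: measurable_coord. Qed.

Lemma measurable_coord_gt (t : Zd d) (c : R) :
  measurable [set f : E | c < (f t : R)].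
Proof.
apply: sub_sigma_algebra; exists t, `]c, +oo[%classic; split => //.
by apply/seteqP; split => f /=; rewrite in_itv/= andbT.
Qed.

Lemma measurable_coord_le (t : Zd d) (c : R) :
  measurable [set f : E | (f t : R) <= c].
Proof.
apply: sub_sigma_algebra; exists t, `]-oo, c]%classic; split => //.
Qed.

Lemma measurable_coord_lt (s t : Zd d) :
  measurable [set f : E | (f s : R) < f t].
Proof.
have := measurable_fun_ltr (@measurable_coord s) (@measurable_coord t).
by move=> /(_ measurableT [set true]); rewrite setTI; apply.
Qed.

Lemma measurable_inE : measurable [set f : E | Defs.inE f].
Proof.
rewrite (_ : [set _ | _] = \bigcap_t ~` [set f : E | (f t : R) < 0]).
  apply: measurable_bigcap_countable => t _; apply: measurableC.
  apply: sub_sigma_algebra; exists t, `]-oo, 0[%classic; split => //.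
apply/seteqP; split => [f f0 t _ /=|f f0 t]; first by apply/negP; rewrite -leNgt.
by have := f0 t I => /= /negP; rewrite -leNgt.
Qed.

Lemma measurable_supf : measurable_fun setT (@supf R d : E -> \bar R).
Proof.
apply: (@measurable_ereal_sup R (Zd d) _ E (fun t f => (f t)%:E)) => t.
by apply/measurable_EFinP; exact: measurable_coord.
Qed.

(* [f^+] instead of [f] because [esum] is only well behaved on nonnegative
   families. *)
Definition Spos (f : E) : \bar R :=
  \esum_(t in [set: Zd d]) (Num.max (f t) 0)%:E.

Lemma measurable_Spos : measurable_fun setT Spos.
Proof.
apply: (@measurable_esum R (Zd d) _ E (fun t f => (Num.max (f t) 0)%:E)).
  move=> t; apply/measurable_EFinP; apply: measurable_maxr => //.
  exact: measurable_coord.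
by move=> t f; rewrite lee_fin le_max lexx orbT.
Qed.

Lemma SposE f : Defs.inE f -> Spos f = SS f.
Proof. by move=> f0; apply: eq_esum => t _; rewrite max_l. Qed.

Lemma BB_ge0 (f : E) : (0 <= BB f)%E.
Proof. by apply: esum_ge0 => t _; rewrite lee_fin; case: ifP. Qed.

Lemma measurable_BB : measurable_fun setT (@BB R d : E -> \bar R).
Proof.
apply: (@measurable_esum R (Zd d) _ E (fun t f => (if 1 < f t then 1 else 0 : R)%:E)).
  move=> t; apply/measurable_EFinP; apply: measurable_fun_ifT => //.
  by apply: measurable_fun_ltr => //; exact: measurable_coord.
by move=> t f; rewrite lee_fin; case: ifP.
Qed.

Lemma ediv_ge0 (a b : \bar R) : (0 <= a)%E -> (0 <= b)%E -> (0 <= ediv a b)%E.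
Proof.
move=> a0; rewrite /ediv; case: b => // r r0; case: ifP => // _.
by rewrite mule_ge0// lee_fin invr_ge0.
Qed.

(** The inverse is x times the power -1 of x^2, a composition of measurable maps; at 0 both sides
    vanish because the inverse of 0 is 0. *)
Lemma measurable_invr : measurable_fun [set: R] (@GRing.inv R).
Proof.
rewrite (_ : @GRing.inv R = fun x => x * (x ^+ 2) `^ (-1)); last first.
  apply/funext => x; rewrite powR_inv1 ?sqr_ge0//.
  have [->|x0] := eqVneq x 0; first by rewrite invr0 mul0r.
  by rewrite expr2 invfM mulrA divff// mul1r.
apply: measurable_funM => //.
apply: (measurableT_comp (@measurable_powR R (-1))).
exact: exprn_measurable.
Qed.

Lemma measurable_ediv {dT : measure_display} {T : measurableType dT}
    (a b : T -> \bar R) : measurable_fun setT a -> measurable_fun setT b ->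
  measurable_fun setT (fun x => ediv (a x) (b x)).
Proof.
move=> ma mb.
have -> : (fun x => ediv (a x) (b x)) =
    (fun x => if b x \is a fin_num then (a x * ((fine (b x))^-1)%:E)%E else 0%E).
  apply/funext => x; case: (b x) => [r| |] //=.
  by case: ifPn => // /eqP ->; rewrite invr0 mule0.
apply: measurable_fun_ifT => //.
  apply: (measurable_fun_bool true).
  by have := emeasurable_fin_num measurableT mb; exact.
apply: emeasurable_funM => //; apply/measurable_EFinP.
apply: measurableT_comp; first exact: measurable_invr.
apply: measurableT_comp => //.
Qed.

End FieldSpace.

(** * Shift invariance, scaling and finiteness of the functionals *)

Section Functionals.
Context {R : realType} {d : nat}.
Implicit Types f : Zd d -> R.

Lemma BshiftD (g h : Zd d) f : Bshift g (Bshift h f) = Bshift (g + h) f.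
Proof. by apply/funext => t; rewrite /Bshift opprD addrA. Qed.

Lemma Bshift0 f : Bshift 0 f = f.
Proof. by apply/funext => t; rewrite /Bshift subr0. Qed.

Lemma BshiftN (h t : Zd d) f : Bshift (- h) f t = f (t + h).
Proof. by rewrite /Bshift opprK. Qed.

Lemma inE_Bshift (h : Zd d) f : Defs.inE f -> Defs.inE (Bshift h f).
Proof. by move=> f0 t; exact: f0. Qed.

Lemma esum_translate (a : Zd d -> \bar R) (h : Zd d) :
  \esum_(t in [set: Zd d]) a (t - h) = \esum_(t in [set: Zd d]) a t.
Proof.
rewrite [RHS](reindex_esum [set: Zd d] _ (fun t => t - h))//.
split=> //; first by move=> s t _ _ /addIr.
by move=> t _; exists (t + h); rewrite ?addrK.
Qed.

Lemma esum_opp (a : Zd d -> \bar R) :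
  \esum_(t in [set: Zd d]) a (- t) = \esum_(t in [set: Zd d]) a t.
Proof. by rewrite [RHS](reindex_esum [set: Zd d] _ (fun t => - t)). Qed.

Lemma Spos_Bshift (h : Zd d) f : Spos (Bshift h f) = Spos f.
Proof. exact: (esum_translate (fun t => (Num.max (f t) 0)%:E)). Qed.

Lemma BB_Bshift (h : Zd d) f : BB (Bshift h f) = BB f.
Proof. exact: (esum_translate (fun t => (if 1 < f t then 1 else 0 : R)%:E)). Qed.

Lemma supf_Bshift (h : Zd d) f : supf (Bshift h f) = supf f.
Proof.
congr ereal_sup; apply/seteqP; split => [_ [t _ <-]|_ [t _ <-]].
  by exists (t - h).
by exists (t + h); rewrite // /Bshift addrK.
Qed.

Lemma SS_ge0 f : Defs.inE f -> (0 <= SS f)%E.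
Proof. by move=> f0; apply: esum_ge0 => t _; rewrite lee_fin. Qed.

Lemma Spos_ge0 f : (0 <= Spos f)%E.
Proof. by apply: esum_ge0 => t _; rewrite lee_fin le_max lexx orbT. Qed.

Lemma supf_ge f t : ((f t)%:E <= supf f)%E.
Proof. by apply: ereal_sup_ubound; exists t. Qed.

Lemma supf_ge0 f : Defs.inE f -> (0 <= supf f)%E.
Proof. by move=> f0; apply: le_trans (supf_ge f 0); rewrite lee_fin. Qed.

Lemma SS_ge f t : Defs.inE f -> ((f t)%:E <= SS f)%E.
Proof.
move=> f0; apply: esum_ge; exists [set t].
  by split => //; exact: finite_set1.
by rewrite fsbig_set1.
Qed.

Lemma BB_ge1 f t : 1 < f t -> (1 <= BB f)%E.
Proof.
move=> ft; apply: esum_ge; exists [set t].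
  by split => //; exact: finite_set1.
by rewrite fsbig_set1 ft.
Qed.

Lemma BB_le_SS f : Defs.inE f -> (BB f <= SS f)%E.
Proof.
move=> f0; apply: le_esum => t _; rewrite lee_fin.
by case: ifPn => // /ltW.
Qed.

Lemma SS_scale f (c : R) : Defs.inE f -> 0 <= c ->
  SS (fun t => (c * f t)%R) = (c%:E * SS f)%E.
Proof.
move=> f0 c0; have cf0 t : 0 <= c * f t by rewrite mulr_ge0.
rewrite /SS !esum_nneseries//.
rewrite -nneseriesZl//; last first.
  by move=> n _; case: pickle_inv => //= t; rewrite lee_fin.
apply: eq_eseriesr => n _; case: pickle_inv => /= [t|]; first by rewrite EFinM.
by rewrite mule0.
Qed.

Lemma supf_scale f (c : R) : 0 < c -> supf (fun t => (c * f t)%R) = (c%:E * supf f)%E.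
Proof.
move=> c0; rewrite /supf -ereal_sup_pZl//; congr ereal_sup.
by rewrite image_comp.
Qed.

Lemma SS_scale_lty f (c : R) : Defs.inE f -> 0 < c ->
  (SS (fun t => (c * f t)%R) < +oo)%E <-> (SS f < +oo)%E.
Proof.
move=> f0 c0; rewrite SS_scale// ?ltW//.
have := SS_ge0 f0; case: (SS f) => [r| |]//= _; first by rewrite -EFinM !ltry.
by rewrite gt0_muley ?lte_fin.
Qed.

Lemma ediv_supf_SS_scale f (c : R) : Defs.inE f -> 0 < c ->
  ediv (supf (fun t => (c * f t)%R)) (SS (fun t => (c * f t)%R)) = ediv (supf f) (SS f).
Proof.
move=> f0 c0; rewrite SS_scale ?(ltW c0)// supf_scale//.
have := SS_ge0 f0; case: (SS f) => [r| |]//= r0; last first.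
  by rewrite gt0_muley ?lte_fin.
rewrite mulf_eq0 gt_eqF//=; case: ifPn => // r1.
rewrite invfM EFinM muleA; congr (_ * _)%E.
by rewrite muleAC -EFinM divff ?gt_eqF// mul1e.
Qed.

Import finmap.

Lemma BB_lty_finite f : (BB f < +oo)%E -> finite_set [set t | 1 < f t].
Proof.
move=> Bf; apply: contrapT => /infinite_set_fsetP inf.
have : (0 <= BB f)%E by exact: BB_ge0.
case E : (BB f) Bf => [b| |]// _ b0.
have [B BA nB] := inf (Num.truncn b).+1.
suff : ((size (enum_fset B))%:R%:E <= BB f)%E.
  rewrite E lee_fin; apply/negP; rewrite -ltNge.
  apply: (lt_le_trans (y := (Num.truncn b).+1%:R)); first exact: truncnS_gt.
  by rewrite ler_nat.
apply: esum_ge; exists [set` B]; first by split.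
rewrite fsbig_finite//= set_fsetK.
rewrite (eq_big_seq (fun=> 1%:E)); last first.
  by move=> t tB; rewrite (BA t tB : 1 < f t).
by rewrite sumEFin big_const_seq count_predT iter_addr_0.
Qed.

(** Markov's inequality: after division by [c] the threshold is 1, and [BB] is bounded by [SS]. *)
Lemma SS_lty_finite f (c : R) : Defs.inE f -> 0 < c -> (SS f < +oo)%E ->
  finite_set [set t | c < f t].
Proof.
move=> f0 c0 Sf.
have f1 : Defs.inE (fun t => c^-1 * f t).
  by move=> t; rewrite mulr_ge0// invr_ge0 ltW.
rewrite (_ : [set _ | _] = [set t | 1 < c^-1 * f t]).
  apply: BB_lty_finite; apply: le_lt_trans (BB_le_SS f1) _.
  by apply/SS_scale_lty => //; rewrite invr_gt0.
by apply/seteqP; split => t /=; rewrite ltr_pdivlMl// mulr1.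
Qed.

End Functionals.

(** Stated for a general relation because it serves both [ord] and the order by decreasing value
    with ties broken by [ord]. *)
Lemma finite_set_least {T : choiceType} (r : rel T) (A : set T) :
  transitive r -> total r -> finite_set A -> A !=set0 ->
  exists2 j, A j & forall k, A k -> r j k.
Proof.
move=> rtr rtot /finite_seqP[s ->] {A} [x /= xs].
elim: s x xs => // a s IH x _.
have [->|s0] := eqVneq s [::].
  exists a => /=; first by rewrite mem_head.
  by move=> k; rewrite mem_seq1 => /eqP ->; have := rtot a a; rewrite orbb.
have [b bs] : exists b, b \in s by case: s s0 {IH} => // b s _; exists b; rewrite mem_head.
have [j /= js jr] := IH b bs.
have /orP[aj|ja] := rtot a j.
  exists a; rewrite /= ?mem_head// => k; rewrite in_cons => /orP[/eqP->|ks].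
    by have := rtot a a; rewrite orbb.
  by apply: rtr aj _; exact: jr.
exists j; first by rewrite /= in_cons js orbT.
move=> k; rewrite /= in_cons => /orP[/eqP->//|]; exact: jr.
Qed.

(** * First exceedance and first maximum *)

Section Selectors.
Context {R : realType} {d : nat}.
Context (ord : rel (Zd d)).
Context (ordP : ti_total_order ord).
Implicit Types f : Zd d -> R.
Local Notation E := (fieldspace R d).

(** Only the event that the origin is selected is defined. Site [j] is selected when the field
    viewed from [j], that is [Bshift (- j) f], lies in the event; finiteness of the set of
    exceedances is not built in. *)
Definition first_exceed f := 1 < f 0 /\ forall k, 1 < f k -> ord 0 k.

Definition first_max f := forall k, f k <= f 0 /\ (f k = f 0 -> ord 0 k).

(** At most one site is selected in each configuration; the existence of a selected exceedance is
    recorded separately by [hits]. *)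
Definition selector (Q : set (Zd d -> R)) :=
  forall f j k, Q (Bshift (- j) f) -> Q (Bshift (- k) f) -> j = k.

Lemma ord_sub j k : ord 0 (k - j) = ord j k.
Proof.
by case: ordP => _ _ _ _ /(_ 0 (k - j) j) ->; rewrite add0r subrK.
Qed.

Lemma ord_anti j k : ord j k -> ord k j -> j = k.
Proof. by case: ordP => _ + _ _ _ => /(_ j k) anti jk kj; apply: anti; rewrite jk. Qed.

Lemma first_exceedN j f : first_exceed (Bshift (- j) f) <->
  1 < f j /\ forall k, 1 < f k -> ord j k.
Proof.
rewrite /first_exceed BshiftN add0r; split => -[fj H]; split => // k.
  by move=> fk; rewrite -ord_sub; apply: H; rewrite BshiftN subrK.
by rewrite BshiftN => /H; rewrite -ord_sub addrK.
Qed.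

Lemma first_maxN j f : first_max (Bshift (- j) f) <->
  forall k, f k <= f j /\ (f k = f j -> ord j k).
Proof.
split => H k.
  by have := H (k - j); rewrite !BshiftN subrK add0r ord_sub.
by rewrite !BshiftN add0r; have := H (k + j); rewrite -ord_sub addrK.
Qed.

Lemma first_exceed_selector : selector first_exceed.
Proof.
move=> f j k /first_exceedN[fj Hj] /first_exceedN[fk Hk].
by apply: ord_anti; [exact: Hj|exact: Hk].
Qed.

Lemma first_max_selector : selector first_max.
Proof.
move=> f j k /first_maxN Hj /first_maxN Hk.
have e : f j = f k by apply/le_anti; rewrite (Hj k).1 (Hk j).1.
by apply: ord_anti; [apply: (Hj k).2|apply: (Hk j).2].
Qed.

Lemma exists_first_exceed f h : finite_set [set t | 1 < f t] -> 1 < f h ->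
  exists2 j, first_exceed (Bshift (- j) f) & 1 < f j.
Proof.
move=> fin fh; case: ordP => _ _ tr tot _.
have [j /= fj Hj] := finite_set_least tr tot fin (ex_intro _ h fh).
by exists j => //; apply/first_exceedN.
Qed.

Lemma exists_first_max f (c : R) h : finite_set [set t | c < f t] -> c < f h ->
  exists2 j, first_max (Bshift (- j) f) & c < f j.
Proof.
move=> fin fh; case: ordP => rf _ tr tot _.
(* Larger values come first, ties are broken by [ord]. A least element among the finitely many sites
   above [c] also beats all sites at or below [c], hence is a global first maximum. *)
pose r j k := (f k < f j) || ((f k == f j) && ord j k).
have rtr : transitive r.
  move=> j i k /orP[ij|/andP[/eqP ij oij]] /orP[jk|/andP[/eqP jk ojk]]; rewrite /r.
  - by rewrite (lt_trans jk ij).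
  - by rewrite jk ij.
  - by rewrite -ij jk.
  - by rewrite jk ij eqxx (tr _ _ _ oij ojk) orbT.
have rtot : total r.
  by move=> j k; rewrite /r; case: ltgtP => //= _; rewrite ?orbT// tot.
have [j /= fj Hj] := finite_set_least rtr rtot fin (ex_intro _ h fh).
exists j => //; apply/first_maxN => k.
have [/Hj/orP[kj|/andP[/eqP kj ojk]]|kc] := ltP c (f k).
- by split; [exact: ltW|move=> e; rewrite e ltxx in kj].
- by rewrite kj.
- have kj := le_lt_trans kc fj.
  by split; [exact: ltW|move=> e; rewrite e ltxx in kj].
Qed.

Lemma minset_unique (M : set (Zd d)) j : M j -> (forall k, M k -> ord j k) ->
  Defs.minset ord M = j.
Proof.
move=> Mj jM; apply: xget_unique; first by split.
by move=> k [Mk kM]; apply: ord_anti; [exact: kM|exact: jM].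
Qed.

Lemma I_fe0P f : Defs.inE f ->
  I_fe ord f = Some 0 <-> first_exceed f /\ (SS f < +oo)%E.
Proof.
move=> f0; rewrite /I_fe; case: pselect => [[Sf supf1]|H]; last first.
  split=> // -[[f1 _] Sf]; exfalso; apply: H; split=> //.
  by apply: lt_le_trans (supf_ge f 0); rewrite lte_fin.
have /ereal_sup_gt[_ [h _ <-]] := supf1; rewrite lte_fin => fh.
have fin := SS_lty_finite f0 ltr01 Sf.
(* The minimum is attained at a genuine site, so the default value 0 of [minset] cannot produce a
   spurious [Some 0]. *)
have [j /first_exceedN[fj Hj] _] := exists_first_exceed fin fh.
rewrite (minset_unique (j := j))//; split => [[j0]|[[f1 Hf] _]].
  by rewrite j0 in fj Hj; split.
by congr Some; apply: ord_anti; [exact: Hj|exact: Hf].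
Qed.

Lemma supf_first_max f : first_max f -> supf f = (f 0)%:E.
Proof.
move=> H; apply/le_anti; rewrite supf_ge andbT; apply: ge_ereal_sup => _ [t _ <-].
by rewrite lee_fin; case: (H t).
Qed.

Lemma I_A0P f : Defs.inE f ->
  I_A ord f = Some 0 <-> [/\ first_max f, 0 < f 0 & (SS f < +oo)%E].
Proof.
move=> f0; rewrite /I_A; case: pselect => [[Sf supf0]|H]; last first.
  split=> // -[fm fpos Sf]; exfalso; apply: H; split=> //.
  by rewrite supf_first_max.
have /ereal_sup_gt[_ [h _ <-]] := supf0; rewrite lte_fin => fh.
(* Half of a positive value [f h] is a threshold that is still positive, so only finitely many sites
   exceed it, and [h] is one of them. *)
have fin := SS_lty_finite f0 (divr_gt0 fh (ltr0Sn R 1)) Sf.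
have [] := exists_first_max fin (h := h); first by rewrite gtr_pMr// invf_lt1// ltr1n.
move=> j fm /(lt_trans (divr_gt0 fh (ltr0Sn R 1))) fj.
have sj : supf f = (f j)%:E.
  by rewrite -(supf_Bshift (- j)) supf_first_max// BshiftN add0r.
move/first_maxN in fm.
rewrite (minset_unique (j := j))//; last first.
  by move=> k /=; rewrite sj => -[]; exact: (fm k).2.
split => [[j0]|[Hf _ _]].
  by rewrite j0 in fj fm; split.
congr Some; apply: (@first_max_selector f); first exact/first_maxN.
by rewrite oppr0 Bshift0.
Qed.

Lemma measurable_first_exceed : measurable [set f : E | first_exceed f].
Proof.
rewrite (_ : [set _ | _] = [set f : E | 1 < f 0] `&`
    \bigcap_(k in [set k | ~~ ord 0 k]) [set f : E | f k <= 1]).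
  apply: measurableI; first exact: measurable_coord_gt.
  by apply: measurable_bigcap_countable => k _; exact: measurable_coord_le.
apply/seteqP; split => f /= [f1 H]; split => // k /=.
  by move=> /negP k0; rewrite leNgt; apply/negP => /H.
by move=> fk; apply: contraLR fk => k0; rewrite -leNgt; exact: H.
Qed.

Lemma measurable_first_max : measurable [set f : E | first_max f].
Proof.
rewrite (_ : [set _ | _] = (\bigcap_k ~` [set f : E | f 0 < f k]) `&`
    \bigcap_(k in [set k | ~~ ord 0 k]) [set f : E | f k < f 0]).
  apply: measurableI; apply: measurable_bigcap_countable => k _.
    by apply: measurableC; exact: measurable_coord_lt.
  exact: measurable_coord_lt.
apply/seteqP; split => f /=.
  move=> H; split => k /=; first by move=> _; apply/negP; rewrite -leNgt; case: (H k).
  move=> k0; have [le0 e] := H k; rewrite lt_neqAle le0 andbT.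
  by apply: contra k0 => /eqP.
move=> [H1 H2] k; split; first by have := H1 k Logic.I => /= /negP; rewrite -leNgt.
by move=> e; apply: contrapT => /negP /H2 /=; rewrite e ltxx.
Qed.

End Selectors.

(** * Mass transport *)

(** Turns a restricted domain into a restricted measure, whose image under a shift can then be
    taken. *)
Lemma ge0_integral_mrestr {dT : measure_display} {T : measurableType dT}
    {R : realType} (mu : {measure set T -> \bar R}) (D : set T)
    (mD : measurable D) (G : T -> \bar R) :
  measurable_fun setT G -> (forall x, (0 <= G x)%E) ->
  (\int[mrestr mu mD]_x G x = \int[mu]_(x in D) G x)%E.
Proof.
move=> mG G0.
rewrite (@ge0_negligible_integral _ _ _ (mrestr mu mD) _ (~` D))//; last 2 first.
- exact: measurableC.
- by rewrite /= /mrestr setICl measure0.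
rewrite setTD setCK; apply: eq_measure_integral => A mA AD.
by rewrite /= /mrestr setIidl.
Qed.

Lemma esumZl {R : realType} {I : countType} (c : R) (a : I -> \bar R) :
  0 <= c -> (forall t, (0 <= a t)%E) ->
  (\esum_(t in [set: I]) (c%:E * a t) = c%:E * \esum_(t in [set: I]) a t)%E.
Proof.
move=> c0 a0; have ca0 t : (0 <= c%:E * a t)%E by rewrite mule_ge0.
rewrite !esum_nneseries// -nneseriesZl; last by move=> n _; case: pickle_inv => /=.
by apply: eq_eseriesr => n _; case: pickle_inv => //=; rewrite mule0.
Qed.

Lemma esum_unique {R : realType} {I : choiceType} (a : I -> \bar R) (j : I) :
  (0 <= a j)%E -> (forall t, t != j -> a t = 0%E) ->
  \esum_(t in [set: I]) a t = a j.
Proof.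
move=> aj a0; rewrite -[RHS](esum_set1 (t := j))// [RHS]esum_mkcond.
apply: eq_esum => t _; case: ifPn => //; rewrite notin_setE /= => /eqP.
exact: a0.
Qed.

Section MassTransport.
Context {R : realType} {d : nat}.
Local Notation E := (fieldspace R d).
Context (mu : probability E R).

(** A Palm-type invariance: the root of the configuration may be moved from the origin to any other
    exceedance. *)
Definition time_change := forall (h : Zd d) (A : set E), measurable A ->
  mu (A `&` [set f | 1 < (f h : R)]) =
  mu ((Bshift h : E -> E) @^-1` A `&` [set f | 1 < (f (- h) : R)]).

Definition exc (f : Zd d -> R) (t : Zd d) : \bar R := (if 1 < f t then 1 else 0)%:E.

Lemma exc_ge0 f t : (0 <= exc f t)%E.
Proof. by rewrite lee_fin; case: ifP. Qed.

Lemma measurable_exc t : measurable_fun setT (exc^~ t : E -> \bar R).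
Proof.
apply/measurable_EFinP; apply: measurable_fun_ifT => //.
by apply: measurable_fun_ltr => //; exact: measurable_coord.
Qed.

Context (tc : time_change).

Lemma integral_exc (h : Zd d) (G : E -> \bar R) :
  (\int[mu]_f (exc f h * G f) = \int[mu]_(f in [set f : E | 1%R < (f h : R)]%R) G f)%E.
Proof.
rewrite [RHS]integral_mkcond; apply: eq_integral => f _; rewrite /exc patchE.
case: ifPn => fh; first by rewrite mem_set// mul1e.
by rewrite mul0e memNset//=; exact/negP.
Qed.

(** Both sides are integrals of [G], against a restriction of [mu] and against the image of another
    restriction under the shift; [time_change] says that these two measures coincide. *)
Lemma integral_time_change (h : Zd d) (G : E -> \bar R) :
  measurable_fun setT G -> (forall f, (0 <= G f)%E) ->
  (\int[mu]_f (exc f h * G f) = \int[mu]_f (exc f (- h)%R * G (Bshift h f)))%E.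
Proof.
move=> mG G0; have mB := @measurable_Bshift R d h.
rewrite !(integral_exc _ G, integral_exc _ (fun f => G (Bshift h f))).
rewrite -!(ge0_integral_mrestr mu (measurable_coord_gt _ _))//; last first.
  exact: (measurableT_comp mG mB).
transitivity (\int[pushforward (mrestr mu (measurable_coord_gt (- h)%R 1%R))
    (Bshift h : E -> E)]_f G f)%E.
  apply: eq_measure_integral => A mA _; rewrite /= /pushforward /mrestr.
  exact: tc.
by rewrite ge0_integral_pushforward.
Qed.

(** The left side is the expected mass sent when the origin gives [g f] to each exceedance. On the
    right the origin receives, from each exceedance [t], the amount [g] prescribes for the field
    viewed from [t]. *)
Lemma mass_transport (g : E -> R) : measurable_fun setT g ->
  (forall f, 0 <= g f) ->
  (\int[mu]_f ((g f)%:E * BB f) =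
   \int[mu]_f (\esum_(t in [set: Zd d]) (exc f t * (g (Bshift (- t)%R f))%:E)))%E.
Proof.
move=> mg g0.
have mgB t : measurable_fun setT (fun f : E => (g (Bshift (- t) f))%:E).
  apply/measurable_EFinP.
  exact: (measurableT_comp mg (@measurable_Bshift R d (- t))).
have mG : measurable_fun setT (fun f : E => (g f)%:E) by exact/measurable_EFinP.
rewrite (@integral_esum R (Zd d) _ E mu (fun t f => exc f t * (g (Bshift (- t)%R f))%:E)%E).
- transitivity (\int[mu]_f (\esum_(t in [set: Zd d]) ((g f)%:E * exc f t)))%E.
    by apply: eq_integral => f _; rewrite esumZl// => t; exact: exc_ge0.
  rewrite (@integral_esum R (Zd d) _ E mu (fun t f => (g f)%:E * exc f t)%E).
  (* The time change moves the exceedance from [h] to [- h], so one sum is reflected before the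
     terms are compared. *)
  + rewrite -esum_opp; apply: eq_esum => t _.
    under eq_integral do rewrite muleC.
    rewrite integral_time_change ?opprK//.
  + by move=> t; apply: emeasurable_funM => //; exact: measurable_exc.
  + by move=> t f; rewrite mule_ge0// ?exc_ge0// lee_fin.
- by move=> t; apply: emeasurable_funM => //; exact: measurable_exc.
- by move=> t f; rewrite mule_ge0// ?exc_ge0// lee_fin.
Qed.

Definition hits (Q : set E) : set E :=
  [set f | exists2 j, Q (Bshift (- j) f) & 1 < (f j : R)].

Lemma measurable_hits Q : measurable Q -> measurable (hits Q).
Proof.
move=> mQ; rewrite (_ : hits Q = \bigcup_j
    ((Bshift (- j) : E -> E) @^-1` Q `&` [set f : E | 1 < (f j : R)])).
  apply: measurable_bigcup_countable => j _; apply: measurableI.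
    by rewrite -[X in measurable X]setTI; exact: measurable_Bshift.
  exact: measurable_coord_gt.
apply/seteqP; split => f /=; first by move=> [j]; exists j.
by move=> [j _ []]; exists j.
Qed.

(** Mass transport for [w f * \1_Q f]: the origin receives from the unique selected exceedance, if
    there is one, and invariance makes the amount [w f]. *)
Lemma selector_transport (Q : set E) (w : E -> R) :
  measurable Q -> selector Q -> measurable_fun setT w -> (forall f, 0 <= w f) ->
  (forall h f, w (Bshift h f) = w f) ->
  (\int[mu]_f ((w f * \1_Q f)%:E * BB f) = \int[mu]_f (w f * \1_(hits Q) f)%:E)%E.
Proof.
move=> mQ sQ mw w0 wB.
rewrite (mass_transport (g := fun f => w f * \1_Q f)); last 2 first.
- by apply: measurable_funM => //; exact: measurable_indic.
- by move=> f; rewrite mulr_ge0.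
apply: eq_integral => f _.
have [[j Qj fj]|nH] := pselect (hits Q f).
  rewrite (esum_unique (j := j)).
  - rewrite /exc fj mul1e wB !indicE !mem_set//; by exists j.
  - by rewrite mule_ge0 ?exc_ge0// lee_fin mulr_ge0.
  - move=> t tj; rewrite /exc; case: ifPn => ft; last by rewrite mul0e.
    rewrite indicE memNset ?mulr0 ?mule0// => Qt.
    by move/eqP: tj; apply; exact: sQ Qt Qj.
rewrite [in RHS]indicE memNset// mulr0; apply: esum1 => t _.
rewrite /exc; case: ifPn => ft; last by rewrite mul0e.
by rewrite indicE memNset ?mulr0 ?mule0// => Qt; apply: nH; exists t.
Qed.

Lemma probability_integral_le1 (g : E -> \bar R) : measurable_fun setT g ->
  (forall f, 0 <= g f <= 1)%E -> (\int[mu]_f g f <= 1)%E.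
Proof.
move=> mg g01; rewrite -(probability_setT mu) -[leRHS]mul1e.
rewrite -(integral_cst _ measurableT).
apply: ge0_le_integral => //= f _; by have /andP[] := g01 f.
Qed.

Lemma measurable_BBy : measurable [set f : E | BB f = +oo%E].
Proof.
have := @measurable_BB R d measurableT [set +oo%E] (emeasurable_set1 _).
by rewrite setTI.
Qed.

(** With the indicator of [BB f = +oo] as weight, the mass sent is infinity times the probability in
    question, while the mass received is at most 1. *)
Lemma selector_BB_infty (Q : set E) : measurable Q -> selector Q ->
  mu (Q `&` [set f | BB f = +oo%E]) = 0%E.
Proof.
move=> mQ sQ; set A := Q `&` _.
have mA : measurable A by apply: measurableI => //; exact: measurable_BBy.
pose w : E -> R := \1_[set f : E | BB f = +oo%E].
have mw : measurable_fun setT w by apply: measurable_indic; exact: measurable_BBy.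
have H : (\int[mu]_f ((w f * \1_Q f)%:E * BB f) <= 1)%E.
  rewrite selector_transport//; last first.
    move=> h f; rewrite /w !indicE; congr (nat_of_bool _)%:R.
    by apply/idP/idP; rewrite !inE /= BB_Bshift.
  apply: probability_integral_le1.
    apply/measurable_EFinP; apply: measurable_funM => //; apply: measurable_indic.
    exact: measurable_hits.
  move=> f; rewrite !lee_fin /w !indicE.
  by do 2 case: (_ \in _); rewrite ?(mulr0,mul0r,mulr1,lexx,ler01).
have : (+oo * mu A <= 1)%E.
  rewrite -(integral_cst mu mA) integral_mkcond; apply: le_trans H.
  rewrite le_eqVlt; apply/orP; left; apply/eqP; apply: eq_integral => f _.
  rewrite patchE /w !indicE; have [fA|fA] := boolP (f \in A).
    by move: fA; rewrite inE => -[Qf By]; rewrite !mem_set//= By mulr1 mul1e.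
  have [Qf|Qf] := boolP (f \in Q); last by rewrite mulr0 mul0e.
  rewrite memNset ?mul0r ?mul0e// => By; move/negP: fA; apply; rewrite inE; split=> //.
  by rewrite inE in Qf.
have : (0 <= mu A)%E by [].
rewrite le_eqVlt => /orP[/eqP <-//|A0]; by rewrite gt0_mulye.
Qed.

(** The weight 1/B is shift invariant. Almost surely 1 <= B < oo on [Q], so the mass sent is [\1_Q].
    The mass received is 1/B everywhere: for finite B some exceedance is selected, and for infinite
    B the weight is 0 by convention. *)
Lemma anchor_probability (Q : set E) : measurable Q -> selector Q ->
  {ae mu, forall f : E, 1 < (f 0 : R)} ->
  {ae mu, forall f : E, (BB f < +oo)%E -> hits Q f} ->
  mu Q = (\int[mu]_f ediv 1 (BB f))%E.
Proof.
move=> mQ sQ ae1 aeH.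
pose w (f : E) : R := fine (ediv 1 (BB f)).
have ediv0 (f : E) : (0 <= ediv 1 (BB f))%E.
  have := BB_ge0 f; rewrite /ediv; case: (BB f) => // r r0; case: ifP => // _.
  by rewrite mul1e lee_fin invr_ge0.
have edivE (f : E) : (w f)%:E = ediv 1 (BB f).
  by rewrite /w /ediv; case: (BB f) => // r; case: ifP => // _; rewrite mul1e.
have medn : measurable_fun setT (fun f : E => ediv 1 (BB f)).
  by apply: measurable_ediv => //; exact: measurable_BB.
have mw : measurable_fun setT w.
  exact: (measurableT_comp (fine_measurable measurableT) medn).
have wB h f : w (Bshift h f) = w f by rewrite /w BB_Bshift.
have w0 f : 0 <= w f by rewrite -lee_fin edivE.
have := selector_transport mQ sQ mw w0 wB.
have -> : (\int[mu]_f (w f * \1_(hits Q) f)%:E = \int[mu]_f ediv 1 (BB f))%E.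
  apply: ge0_ae_eq_integral => //.
  - apply/measurable_EFinP; apply: measurable_funM => //; apply: measurable_indic.
    exact: measurable_hits.
  - by move=> f _; rewrite lee_fin mulr_ge0.
  - apply: filterS aeH => f Hf _; rewrite -edivE.
    have [By|By] := pselect (BB f < +oo)%E; first by rewrite indicE mem_set ?mulr1//; exact: Hf.
    by rewrite /w; have := BB_ge0 f; case: (BB f) By => [r| |]//= + _; rewrite ?ltry// mul0r.
move <-; rewrite -[in LHS](setIT Q) -(integral_indic mu measurableT mQ).
have A0 := selector_BB_infty mQ sQ.
have ae2 : {ae mu, forall f : E, Q f -> BB f != +oo%E}.
  exists (Q `&` [set f | BB f = +oo%E]); split => //.
    by apply: measurableI => //; exact: measurable_BBy.
  by move=> f /= /not_implyP[Qf /negP]; rewrite negbK => /eqP.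
apply: ge0_ae_eq_integral => //.
- by apply/measurable_EFinP; apply: measurable_indic.
- apply: emeasurable_funM; last exact: measurable_BB.
  by apply/measurable_EFinP; apply: measurable_funM => //; exact: measurable_indic.
- by move=> f _; rewrite mule_ge0 ?BB_ge0// lee_fin mulr_ge0.
- apply: filterS2 ae1 ae2 => f f1 Qy _.
  rewrite indicE; have [|Qf] := boolP (f \in Q); last by rewrite mulr0 mul0e.
  rewrite inE => /Qy; rewrite mulr1 edivE /ediv.
  have := BB_ge1 f1; case: (BB f) => // r r1 _.
  rewrite lee_fin in r1; have r0 := lt_le_trans ltr01 r1.
  by rewrite gt_eqF// mul1e -EFinM mulVf// gt_eqF.
Qed.

End MassTransport.

(** * Integrating out the Pareto variable *)

Section Law.
Context {d1 d2 : measure_display} {T : measurableType d1} {T' : measurableType d2}.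
Context {R : realType} (P : probability T R).

Definition law (F : T -> T') (mF : measurable_fun setT F) : probability T' R :=
  distribution P (mfun_Sub (mem_set mF)).

Lemma ge0_integral_law (F : T -> T') (mF : measurable_fun setT F)
    (g : T' -> \bar R) : measurable_fun setT g -> (forall y, (0 <= g y)%E) ->
  (\int[law mF]_y g y = \int[P]_x g (F x))%E.
Proof. by move=> mg g0; rewrite ge0_integral_distribution. Qed.

End Law.

Section Pareto.
Context {R : realType} {d1 d2 : measure_display} {T : measurableType d1}.
Context {E : measurableType d2} (P : probability T R).
Context (Theta : T -> E) (Rp : T -> R).
Context (mTheta : measurable_fun setT Theta) (mRp : measurable_fun setT Rp).
Context (pareto : forall x : R, 1 <= x -> P [set w | x < Rp w] = (x^-1)%:E).
Context (indep : forall (B : set R) (A : set E), measurable B -> measurable A ->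
  P [set w | B (Rp w) /\ A (Theta w)] =
  (P [set w | B (Rp w)] * P [set w | A (Theta w)])%E).

Lemma pareto_gt1 : {ae P, forall w, 1 < Rp w}.
Proof.
have H := pareto (lexx 1); rewrite invr1 in H.
have mA : measurable [set w | 1 < Rp w].
  rewrite (_ : [set _ | _] = Rp @^-1` `]1, +oo[).
    by rewrite -[X in measurable X]setTI; exact: mRp.
  by apply/seteqP; split => w /=; rewrite in_itv/= andbT.
exists (~` [set w | 1 < Rp w]); split => //; first exact: measurableC.
by rewrite probability_setC//= H subee.
Qed.

Lemma pareto_scaled (m : R) : 0 <= m ->
  P [set w | 1 < Rp w * m] = (Num.min m 1)%:E.
Proof.
move=> m0; have [->|mn0] := eqVneq m 0.
  rewrite min_l// (_ : [set _ | _] = set0) ?measure0//.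
  by apply/seteqP; split => w //=; rewrite mulr0 ltr10.
have {m0 mn0} m0 : 0 < m by rewrite lt_neqAle eq_sym mn0.
have -> : [set w | 1 < Rp w * m] = [set w | m^-1 < Rp w].
  by apply/seteqP; split => w /=; rewrite -ltr_pdivrMr// mul1r.
have [m1|m1] := leP m 1.
  by rewrite pareto ?invrK// invr_ge1// unitfE gt_eqF.
have mA c : measurable [set w | c < Rp w].
  rewrite (_ : [set _ | _] = Rp @^-1` `]c, +oo[).
    by rewrite -[X in measurable X]setTI; exact: mRp.
  by apply/seteqP; split => w /=; rewrite in_itv/= andbT.
(* For [m] > 1 the event contains that of [Rp] > 1, which already has probability 1. *)
apply/le_anti; rewrite probability_le1//=.
have := pareto (lexx 1); rewrite invr1 => <-; apply: le_measure; rewrite ?inE//.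
by move=> w /=; apply: lt_trans; rewrite invf_lt1.
Qed.

(** By independence the joint law is a product; Tonelli integrates the Pareto variable first, with
    the other argument frozen, and [pareto_scaled] evaluates the inner integral. *)
Lemma integral_pareto (g : E -> \bar R) (m : E -> R) :
  measurable_fun setT g -> (forall x, (0 <= g x)%E) ->
  measurable_fun setT m -> (forall x, 0 <= m x) ->
  (\int[P]_w (g (Theta w) * (if (1 < Rp w * m (Theta w))%R then 1 else 0)%:E) =
   \int[P]_w (g (Theta w) * (Num.min (m (Theta w)) 1)%:E))%E.
Proof.
move=> mg g0 mm m0.
have mJ : measurable_fun setT (fun w => (Rp w, Theta w)).
  exact: (measurable_fun_pair mRp mTheta).
pose F (z : R * E) : \bar R := (g z.2 * (if (1 < z.1 * m z.2)%R then 1 else 0)%:E)%E.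
have mF : measurable_fun setT F.
  apply: emeasurable_funM; first exact: (measurableT_comp mg measurable_snd).
  apply/measurable_EFinP; apply: measurable_fun_ifT => //.
  apply: measurable_fun_ltr => //; apply: measurable_funM => //.
  exact: (measurableT_comp mm measurable_snd).
have F0 z : (0 <= F z)%E by rewrite mule_ge0// lee_fin; case: ifP.
transitivity (\int[law P mJ]_z F z)%E; first by rewrite ge0_integral_law.
transitivity (\int[law P mRp \x law P mTheta]_z F z)%E.
  apply: eq_measure_integral => A mA _; apply/esym.
  by apply: product_measure_unique => // B C mB mC; exact: indep.
rewrite fubini_tonelli2// ge0_integral_law; last 2 first.
- exact: measurable_fun_fubini_tonelli_G.
- by move=> y; apply: integral_ge0.
apply: eq_integral => w _; rewrite /fubini_G /F /=.
have mS : measurable [set r : R | 1 < r * m (Theta w)].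
  have := measurable_fun_ltr (@measurable_cst _ _ R R setT 1)
     (@mulrr_measurable R setT (m (Theta w))).
  by move=> /(_ measurableT [set true]); rewrite setTI; apply.
under eq_integral => r _.
  rewrite (_ : (if _ then _ else _) = \1_[set r : R | 1 < r * m (Theta w)] r); last first.
    rewrite indicE; case: ifPn => H; first by rewrite mem_set.
    by rewrite memNset//; exact/negP.
  over.
rewrite ge0_integralZl//; last by apply/measurable_EFinP; exact: measurable_indic.
by rewrite integral_indic// setIT -pareto_scaled.
Qed.

End Pareto.

(** * From a density identity on events to nonnegative functions *)

Section ChangeOfMeasure.
Import HBNNSimple.
Context {R : realType} {d1 d2 d3 : measure_display}.
Context {T1 : measurableType d1} {T2 : measurableType d2} {E : measurableType d3}.
Context (m1 : {measure set T1 -> \bar R}) (m2 : {measure set T2 -> \bar R}).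
Context (F1 : T1 -> E) (F2 : T2 -> E) (z : T2 -> R).
Context (mF1 : measurable_fun setT F1) (mF2 : measurable_fun setT F2).
Context (mz : measurable_fun setT z) (z0 : forall x, 0 <= z x).
Context (H : forall A : set E, measurable A ->
  m1 (F1 @^-1` A) = (\int[m2]_x (z x * \1_A (F2 x))%:E)%E).
Local Open Scope ereal_scope.

Lemma change_of_measure_simple (n : nat) (c : 'I_n -> R) (A : 'I_n -> set E) :
  (forall i, (0 <= c i)%R) -> (forall i, measurable (A i)) ->
  \int[m1]_x (\sum_(i < n) c i * \1_(A i) (F1 x))%R%:E =
  \int[m2]_x ((z x)%:E * (\sum_(i < n) c i * \1_(A i) (F2 x))%R%:E).
Proof.
move=> c0 mA.
have mAF (T : measurableType _) (F : T -> E) i : measurable_fun setT F ->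
    measurable_fun setT (fun x => \1_(A i) (F x) : R).
  move=> mF; exact: (measurableT_comp (measurable_indic (mA i)) mF).
transitivity (\sum_(i < n) (c i)%:E * m1 (F1 @^-1` A i)).
  under eq_integral do rewrite -sumEFin.
  rewrite ge0_integral_sum//; last 2 first.
  - move=> i; apply/measurable_EFinP; apply: measurable_funM => //; exact: mAF.
  - by move=> i x _; rewrite lee_fin mulr_ge0.
  apply: eq_bigr => i _; under eq_integral do rewrite EFinM.
  have mAi : measurable (F1 @^-1` A i).
    by rewrite -[X in measurable X]setTI; exact: mF1.
  rewrite ge0_integralZl_EFin//; last by apply/measurable_EFinP; exact: mAF.
  by rewrite -[X in m1 X]setIT -integral_indic.
transitivity (\int[m2]_x (\sum_(i < n) ((c i)%:E * (z x * \1_(A i) (F2 x))%:E))); last first.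
  apply: eq_integral => x _; rewrite -EFinM mulr_sumr -sumEFin.
  by apply: eq_bigr => i _; rewrite -EFinM mulrCA.
rewrite ge0_integral_sum//; last 2 first.
- move=> i; apply/measurable_EFinP; apply: measurable_funM => //.
  by apply: measurable_funM => //; exact: mAF.
- by move=> i x _; rewrite lee_fin !mulr_ge0.
apply: eq_bigr => i _; rewrite H//.
rewrite ge0_integralZl_EFin//.
- by move=> x _; rewrite lee_fin mulr_ge0.
- by apply/measurable_EFinP; apply: measurable_funM => //; exact: mAF.
Qed.

(** Linearity settles simple functions; increasing simple approximations of [G] and monotone
    convergence on both sides give the general case. *)
Lemma change_of_measure (G : E -> \bar R) :
  measurable_fun setT G -> (forall x, 0 <= G x) ->
  \int[m1]_x G (F1 x) = \int[m2]_x ((z x)%:E * G (F2 x)).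
Proof.
move=> mG G0.
pose h n : E -> R := nnsfun_approx measurableT mG n.
have hG (x : E) : (h n x)%:E @[n --> \oo] --> G x.
  exact: (cvg_nnsfun_approx measurableT mG (fun y _ => G0 y) (x := x)).
have h0 n x : (0 <= h n x)%R by rewrite /h.
have mh n : measurable_fun setT (h n) by rewrite /h.
have hnd x : {homo h^~ x : n m / (n <= m)%N >-> (n <= m)%R}.
  move=> n m nm; have := nd_nnsfun_approx measurableT mG nm.
  by move=> /asboolP/(_ x).
have hE n : \int[m1]_x (h n (F1 x))%:E = \int[m2]_x ((z x)%:E * (h n (F2 x))%:E).
  have := fimfunEord (nnsfun_approx measurableT mG n) => /= hs.
  under eq_integral do rewrite /h hs.
  rewrite change_of_measure_simple//.
  - by apply: eq_integral => x _; rewrite /h hs.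
  - move=> i; set s := fset_set _.
    have : nth 0%R (finmap.enum_fset s) i \in finmap.enum_fset s.
      by apply: mem_nth; rewrite ltn_ord.
    by rewrite (in_fset_set (fimfunP _)) inE => -[x _ <-].
have c1 : \int[m1]_x (h n (F1 x))%:E @[n --> \oo] --> \int[m1]_x G (F1 x).
  rewrite (eq_integral (fun x => limn (fun n => (h n (F1 x))%:E))); last first.
    by move=> x _; apply/esym/cvg_lim => //; exact: hG.
  apply: cvg_monotone_convergence => //.
  - by move=> n; apply/measurable_EFinP; exact: (measurableT_comp (mh n) mF1).
  - by move=> n x _; rewrite lee_fin.
  - by move=> x _ n m nm; rewrite lee_fin hnd.
have c2 : \int[m2]_x ((z x)%:E * (h n (F2 x))%:E) @[n --> \oo] -->
    \int[m2]_x ((z x)%:E * G (F2 x)).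
  rewrite (eq_integral (fun x => limn (fun n => (z x)%:E * (h n (F2 x))%:E))); last first.
    by move=> x _; apply/esym/cvg_lim => //; apply: cvgeZl => //; exact: hG.
  apply: cvg_monotone_convergence => //.
  - move=> n; apply: emeasurable_funM; apply/measurable_EFinP => //.
    exact: (measurableT_comp (mh n) mF2).
  - by move=> n x _; rewrite lee_fin mulr_ge0.
  - by move=> x _ n m nm; rewrite lee_fin ler_wpM2l// hnd.
rewrite -(cvg_lim _ c1)//.
under eq_fun do rewrite hE.
exact: (cvg_lim _ c2).
Qed.

End ChangeOfMeasure.

(** * The time-change formula *)

Section Rectangles.
Context {R : realType} {d : nat}.
Local Notation E := (fieldspace R d).
Implicit Types (s : seq (Zd d * R)) (f : Zd d -> R).

(** These sets form a generating family closed under intersection, by concatenation of lists; a site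
    may occur several times. *)
Definition rect s : set E := [set f | forall p, p \in s -> (f p.1 : R) <= p.2].

(** The starting value 0 is harmless for nonnegative fields and gives the empty list exponent 0. *)
Definition mx s f : R := \big[Num.max/0]_(p <- s) (f p.1 / p.2).

Definition positive s := forall p, p \in s -> 0 < p.2.

Lemma rect_cons p s : rect (p :: s) = [set f | (f p.1 : R) <= p.2] `&` rect s.
Proof.
apply/seteqP; split => [f H|f [fp fs] q].
  by split=> [|q qs]; apply: H; rewrite in_cons ?eqxx// qs orbT.
by rewrite in_cons => /orP[/eqP->//|]; exact: fs.
Qed.

Lemma rect_nil : rect [::] = setT.
Proof. by apply/seteqP; split. Qed.

Lemma rect_cat s1 s2 : rect (s1 ++ s2) = rect s1 `&` rect s2.
Proof.
elim: s1 => [|p s IH]; first by rewrite rect_nil setTI.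
by rewrite cat_cons !rect_cons IH setIA.
Qed.

Lemma measurable_rect s : measurable (rect s).
Proof.
elim: s => [|p s IH]; first by rewrite rect_nil.
by rewrite rect_cons; apply: measurableI => //; exact: measurable_coord_le.
Qed.

Lemma mx_cons p s f : mx (p :: s) f = Num.max (f p.1 / p.2) (mx s f).
Proof. by rewrite /mx big_cons. Qed.

Lemma mx_ge0 s f : 0 <= mx s f.
Proof.
elim: s => [|p s IH]; first by rewrite /mx big_nil.
by rewrite mx_cons le_max IH orbT.
Qed.

Lemma measurable_mx s : measurable_fun setT (mx s : E -> R).
Proof.
elim: s => [|p s IH].
  have -> : mx [::] = (fun=> 0) by apply/funext => f; rewrite /mx big_nil.
  exact: measurable_cst.
have -> : mx (p :: s) = (fun f => Num.max (f p.1 / p.2) (mx s f)).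
  by apply/funext => f; rewrite mx_cons.
apply: measurable_maxr => //; apply: measurable_funM => //.
exact: measurable_coord.
Qed.

Lemma mx_le1 s f : positive s -> mx s f <= 1 <-> rect s f.
Proof.
elim: s => [|p s IH] s0.
  by rewrite rect_nil /mx big_nil; split.
have p0 : 0 < p.2 by apply: s0; rewrite mem_head.
have /IH{}IH : positive s by move=> q qs; apply: s0; rewrite in_cons qs orbT.
rewrite mx_cons rect_cons ge_max ler_pdivrMr// mul1r; split.
  by move=> /andP[fp /IH fs]; split.
by move=> [fp /IH fs]; apply/andP.
Qed.

Lemma mx_scale s f (c : R) : 0 <= c -> mx s (fun t => c * f t) = c * mx s f.
Proof.
move=> c0; elim: s => [|p s IH]; first by rewrite /mx !big_nil mulr0.
by rewrite !mx_cons IH maxr_pMr// mulrA.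
Qed.

Lemma rect_sigma_algebra (A : set E) : measurable A ->
  <<s [set B : set E | exists s, B = rect s] >> A.
Proof.
set G := [set B | _]; apply: smallest_sub; first exact: smallest_sigma_algebra.
move=> _ [t [B [mB ->]]].
have : measurable_fun setT (fun f : g_sigma_algebraType G => (f t : R)).
  apply: (measurability _ (RGenOInfty.measurableE R)) => _ [_ [x ->] <-].
  rewrite setTI (_ : _ @^-1` _ = ~` rect [:: (t, x)]).
    by apply: measurableC; apply: sub_sigma_algebra; exists [:: (t, x)].
  apply/seteqP; split => f /=; rewrite in_itv/= andbT rect_cons rect_nil setIT /=.
    by move=> xf; apply/negP; rewrite -ltNge.
  by move=> /negP; rewrite -ltNge.
by move=> /(_ measurableT _ mB); rewrite setTI.
Qed.

Lemma measure_rect_unique (m1 m2 : {measure set E -> \bar R}) :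
  (m1 setT < +oo)%E -> (forall s, m1 (rect s) = m2 (rect s)) ->
  forall A : set E, measurable A -> m1 A = m2 A.
Proof.
move=> m1y H A /rect_sigma_algebra.
apply: (@g_sigma_algebra_measure_unique _ _ E _ _ (fun=> rect [::])) => //.
- by move=> _ [s ->]; exact: measurable_rect.
- by move=> _; exists [::].
- by rewrite rect_nil bigcup_const.
- by move=> _ _ [s1 ->] [s2 ->]; exists (s1 ++ s2); rewrite rect_cat.
- by move=> _ [s ->].
- by move=> _; rewrite rect_nil.
Qed.

(** The exponent is available for positive thresholds only. A rectangle with a negative threshold is
    null, since the fields are nonnegative almost everywhere; one with nonnegative thresholds is the
    decreasing limit of those enlarged by 1/(n+1). *)
Lemma measure_rect_pos_unique (m1 m2 : {measure set E -> \bar R}) :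
  (m1 setT < +oo)%E -> (m2 setT < +oo)%E ->
  m1 (~` [set f | Defs.inE f]) = 0%E -> m2 (~` [set f | Defs.inE f]) = 0%E ->
  (forall s, positive s -> m1 (rect s) = m2 (rect s)) ->
  forall A : set E, measurable A -> m1 A = m2 A.
Proof.
move=> m1y m2y m10 m20 H; apply: measure_rect_unique => // s.
have [s0|/existsNP[p /not_implyP[ps /negP]]] :=
  pselect (forall p, p \in s -> 0 <= p.2); last first.
  rewrite -ltNge => p0.
  have sub : rect s `<=` ~` [set f | Defs.inE f].
    by move=> f /(_ p ps) fp /(_ p.1); rewrite leNgt (le_lt_trans fp p0).
  have mC : measurable (~` [set f : E | Defs.inE f]) by apply: measurableC; exact: measurable_inE.
  have z (m : {measure set E -> \bar R}) : m (~` [set f | Defs.inE f]) = 0%E -> m (rect s) = 0%E.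
    by move=> m0; apply: (subset_measure0 _ mC) => //; exact: measurable_rect.
  by rewrite !z.
pose sn n := [seq (p.1, p.2 + n.+1%:R^-1) | p <- s].
have sn0 n : positive (sn n).
  by move=> _ /mapP[p ps ->] /=; rewrite ltr_wpDl ?s0// invr_gt0 ltr0n.
have capE : \bigcap_n rect (sn n) = rect s.
  apply/seteqP; split => f H1.
    move=> p ps; apply/ler_addgt0Pr => e e0.
    have [n _ /(_ n (leqnn _)) ne] := near_infty_natSinv_lt (PosNum e0).
    apply: le_trans (H1 n Logic.I (p.1, p.2 + n.+1%:R^-1) _) _.
      by apply/mapP; exists p.
    by rewrite /= lerD2l ltW.
  move=> n _ _ /mapP[p ps ->] /=; apply: le_trans (H1 p ps) _.
  by rewrite lerDl invr_ge0.
have nI : {homo (rect \o sn) : n m / (n <= m)%N >-> (m <= n)%O}.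
  move=> n m nm; apply/subsetPset => f H1 _ /mapP[p ps ->] /=.
  apply: le_trans (H1 (p.1, p.2 + m.+1%:R^-1) _) _.
    by apply/mapP; exists p.
  by rewrite /= lerD2l lef_pV2 ?posrE ?ltr0n// ler_nat ltnS.
have cvg (m : {measure set E -> \bar R}) : (m setT < +oo)%E ->
    m (rect (sn n)) @[n --> \oo] --> m (rect s).
  move=> my; rewrite -capE; apply: (@nonincreasing_cvg_mu _ _ _ m (rect \o sn)) => //.
  - by apply: le_lt_trans my; apply: le_measure; rewrite ?inE//; exact: measurable_rect.
  - by move=> n; exact: measurable_rect.
  - by rewrite capE; exact: measurable_rect.
have := cvg m1 m1y; under eq_fun do rewrite H//.
by move=> /cvg_lim <-//; apply: cvg_lim => //; exact: cvg.
Qed.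

End Rectangles.

(** * The exponent of the max-stable field and the law of the tail field *)

Section Spectral.
Context {R : realType} {d : nat} {d1 d2 d3 : measure_display}.
Context {T1 : measurableType d1} {T2 : measurableType d2} {T3 : measurableType d3}.
Context (P1 : probability T1 R) (P2 : probability T2 R) (P3 : probability T3 R).
Context (X : T1 -> Zd d -> R) (Z : T2 -> Zd d -> R).
Context (Theta : T3 -> Zd d -> R) (Rp : T3 -> R).
Local Notation E := (fieldspace R d).
Context (Xstat : forall (h : Zd d) (A : set (Zd d -> R)), prodF A ->
  P1 [set w | A (X w)] = P1 [set w | A (Bshift h (X w))]).
Context (mZ : forall t, measurable_fun setT (fun w => Z w t)).
Context (Z0 : forall w t, 0 <= Z w t).
Context (EZ : forall t, (\int[P2]_w (Z w t)%:E = 1)%E).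
Context (XZ : forall (n : nat) (t : 'I_n -> Zd d) (x : 'I_n -> R),
  (forall i, 0 < x i) ->
  (- ln (fine (P1 [set w | forall i, X w (t i) <= x i])))%:E
    = (\int[P2]_w (\big[Num.max/0]_(i < n) (Z w (t i) / x i))%:E)%E).
Context (mTheta : forall t, measurable_fun setT (fun w => Theta w t)).
Context (Theta0 : forall w t, 0 <= Theta w t).
Context (ThetaZ : forall A : set (Zd d -> R), prodF A ->
  P3 [set w | A (Theta w)]
    = (\int[P2]_w (Z w 0 * \1_A (fun t => Z w t / Z w 0))%:E)%E).
Context (mRp : measurable_fun setT Rp).
Context (pareto : forall x : R, 1 <= x -> P3 [set w | x < Rp w] = (x^-1)%:E).
Context (indep : forall (B : set R) (A : set (Zd d -> R)), measurable B ->
  prodF A -> P3 [set w | B (Rp w) /\ A (Theta w)]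
    = (P3 [set w | B (Rp w)] * P3 [set w | A (Theta w)])%E).

Definition Vexp (s : seq (Zd d * R)) : \bar R := (\int[P2]_w (mx s (Z w))%:E)%E.

Lemma mZE : measurable_fun setT (Z : T2 -> E).
Proof. exact: measurable_field. Qed.

Lemma mThetaE : measurable_fun setT (Theta : T3 -> E).
Proof. exact: measurable_field. Qed.

Lemma Vexp_law s : positive s ->
  Vexp s = (- ln (fine (P1 [set w | rect s (X w)])))%:E.
Proof.
move=> s0; pose u := tnth (in_tuple s).
transitivity (\int[P2]_w (\big[Num.max/0]_(i < size s) (Z w (u i).1 / (u i).2))%:E)%E.
  by apply: eq_integral => w _; rewrite /mx big_tnth.
rewrite -(XZ (fun i => (u i).1) (x := fun i => (u i).2)); last first.
  by move=> i; apply: s0; exact: mem_tnth.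
congr (- ln (fine (P1 _)))%:E; apply/seteqP; split => w /= H.
  by move=> p /(tnthP (in_tuple s))[i ->]; exact: H.
by move=> i; apply: H; exact: mem_tnth.
Qed.

Lemma Vexp_fin_num s : positive s -> Vexp s \is a fin_num.
Proof. by move=> s0; rewrite Vexp_law. Qed.

Definition shift_seq (h : Zd d) (s : seq (Zd d * R)) := [seq (p.1 + h, p.2) | p <- s].

Lemma rect_shift h s (f : Zd d -> R) : rect (shift_seq h s) f <-> rect s (Bshift (- h) f).
Proof.
split => H p.
  by move=> ps; rewrite BshiftN; apply: (H (p.1 + h, p.2)); apply/mapP; exists p.
by move=> /mapP[q qs ->] /=; rewrite -BshiftN; exact: H.
Qed.

Lemma positive_shift h s : positive s -> positive (shift_seq h s).
Proof. by move=> s0 p /mapP[q qs ->] /=; exact: s0. Qed.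

Lemma Vexp_shift h s : positive s -> Vexp (shift_seq h s) = Vexp s.
Proof.
move=> s0; rewrite !Vexp_law//; last exact: positive_shift.
rewrite [in RHS](Xstat (- h)); last exact: measurable_rect.
congr (- ln (fine (P1 _)))%:E; apply/seteqP; by split => w /= /rect_shift.
Qed.

Definition Vr s : R := fine (Vexp s).

Lemma integral_Theta (G : E -> \bar R) : measurable_fun setT G ->
  (forall f, 0 <= G f)%E ->
  (\int[P3]_w G (Theta w) =
   \int[P2]_w ((Z w 0%R)%:E * G (fun t => (Z w t / Z w 0)%R)))%E.
Proof.
apply: (change_of_measure (F2 := fun w => (fun t => Z w t / Z w 0) : E)) => //.
- exact: mThetaE.
- apply: measurable_field => t; apply: measurable_funM => //.
  exact: (measurableT_comp (@measurable_invr R) (mZ 0)).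
Qed.

(** The ratio is invariant under scaling, so Z/Z(0) may be replaced by Z; where Z(0) = 0 the weight
    annihilates both sides. *)
Lemma integral_Theta_sup_over_sum :
  (\int[P3]_w ediv (supf (Theta w)) (SS (Theta w)) =
   \int[P2]_w ((Z w 0%R)%:E * ediv (supf (Z w)) (SS (Z w))))%E.
Proof.
(* The truncations make [W] nonnegative and measurable on all real fields, as [integral_Theta]
   requires. *)
pose W (f : E) := ediv (maxe 0%E (supf f)) (Spos f).
have WE f : Defs.inE f -> W f = ediv (supf f) (SS f).
  by move=> f0; rewrite /W SposE// max_r// supf_ge0.
transitivity (\int[P3]_w W (Theta w))%E.
  by apply: eq_integral => w _; rewrite WE.
rewrite integral_Theta; last 2 first.
- apply: measurable_ediv; last exact: measurable_Spos.
  by apply: measurable_maxe => //; exact: measurable_supf.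
- by move=> f; rewrite ediv_ge0 ?Spos_ge0// le_max lexx.
apply: eq_integral => w _.
have [->|z0] := eqVneq (Z w 0) 0; first by rewrite !mul0e.
have zp : 0 < Z w 0 by rewrite lt_neqAle eq_sym z0 Z0.
rewrite (_ : (fun t => _) = (fun t => (Z w 0)^-1 * Z w t)); last first.
  by apply/funext => t; rewrite mulrC.
rewrite WE; last by move=> t; rewrite mulr_ge0// invr_ge0.
by rewrite ediv_supf_SS_scale// invr_gt0.
Qed.

(** Integrating out [Rp] gives the mean of min(mx(Theta), 1); the change of measure multiplies by
    Z(0), which cancels the normalisation inside the minimum. *)
Lemma tail_exceed s : positive s ->
  P3 [set w | 1 < Rp w * mx s (Theta w)] =
  (\int[P2]_w (Num.min (mx s (Z w)) (Z w 0))%:E)%E.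
Proof.
move=> s0.
have mA : measurable [set w | 1 < Rp w * mx s (Theta w)].
  have mm : measurable_fun setT (fun w => Rp w * mx s (Theta w)).
    by apply: measurable_funM => //; exact: (measurableT_comp (measurable_mx s) mThetaE).
  have := mm measurableT `]1, +oo[%classic; rewrite setTI.
  rewrite (_ : _ @^-1` _ = [set w | 1 < Rp w * mx s (Theta w)]); first exact.
  by apply/seteqP; split => w /=; rewrite in_itv/= andbT.
rewrite -[X in P3 X]setIT -integral_indic//.
have := @integral_pareto R _ _ T3 E P3 Theta Rp mThetaE mRp pareto indep
  (fun=> 1%E) (mx s).
move=> /(_ (measurable_cst _) (fun=> lee01)).
move=> /(_ (measurable_mx s) (mx_ge0 s)) H.
transitivity (\int[P3]_w (1 * (if (1 < Rp w * mx s (Theta w))%R then 1 else 0)%:E)%E)%E.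
  apply: eq_integral => w _; rewrite mul1e indicE; case: ifPn => h.
    by rewrite mem_set.
  by rewrite memNset//; exact/negP.
rewrite H (integral_Theta (G := fun f => 1 * (Num.min (mx s f) 1)%:E)%E); last 2 first.
- apply: emeasurable_funM => //; apply/measurable_EFinP.
  by apply: measurable_minr => //; exact: measurable_mx.
- by move=> f; rewrite mul1e lee_fin le_min mx_ge0 ler01.
apply: eq_integral => w _; rewrite mul1e -EFinM.
have [->|z0] := eqVneq (Z w 0) 0; first by rewrite mul0r min_r// mx_ge0.
have zp : 0 < Z w 0 by rewrite lt_neqAle eq_sym z0 Z0.
rewrite (_ : (fun t => _) = (fun t => (Z w 0)^-1 * Z w t)); last first.
  by apply/funext => t; rewrite mulrC.
rewrite mx_scale ?invr_ge0 ?ltW// minr_pMr ?ltW//.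
by rewrite mulrA divff// mul1r mulr1.
Qed.

Definition Ytail w t := Rp w * Theta w t.

Lemma mY : measurable_fun setT (Ytail : T3 -> E).
Proof. by apply: measurable_field => t; exact: measurable_funM. Qed.

(** The complement has probability E[min(mx(Z), Z(0))] by [tail_exceed]. Since min + max = sum and
    E[Z(0)] = 1, this is [Vr s] + 1 minus [Vr ((0, 1) :: s)]. *)
Lemma Y_rect s : positive s ->
  P3 [set w | rect s (Ytail w)] = (Vr ((0, 1) :: s) - Vr s)%:E.
Proof.
move=> s0.
have s10 : positive ((0, 1) :: s).
  by move=> p; rewrite in_cons => /orP[/eqP->//|]; exact: s0.
have mms : measurable_fun setT (fun w => mx s (Z w)).
  exact: (measurableT_comp (measurable_mx s) mZE).
have mA : measurable [set w | rect s (Ytail w)].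
  rewrite (_ : [set _ | _] = (Ytail : T3 -> E) @^-1` rect s)//.
  by rewrite -[X in measurable X]setTI; apply: mY => //; exact: measurable_rect.
have AE : [set w | 1 < Rp w * mx s (Theta w)] = ~` [set w | rect s (Ytail w)].
  (* [Rp] may be negative on a null event; there both conditions hold, so the equivalence is valid
     for every [w]. *)
  suff H w : rect s (Ytail w) <-> Rp w * mx s (Theta w) <= 1.
    apply/seteqP; split => w /=.
      by move=> r1 /H; rewrite leNgt r1.
    by move=> r1; rewrite ltNge; apply/negP => /H.
  have [R0|R0] := leP 0 (Rp w).
    by rewrite -mx_scale//; apply: iff_sym; exact: mx_le1.
  split=> _.
    apply: le_trans ler01; apply: mulr_le0_ge0; [exact: ltW|exact: mx_ge0].
  move=> p ps; apply: le_trans (ltW (s0 p ps)).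
  by apply: mulr_le0_ge0; [exact: ltW|exact: Theta0].
have mmin : measurable_fun setT (fun w => Num.min (mx s (Z w)) (Z w 0)).
  exact: measurable_minr.
have mms1 : measurable_fun setT (fun w => mx ((0, 1) :: s) (Z w)).
  exact: (measurableT_comp (measurable_mx _) mZE).
have minmax : (\int[P2]_w (Num.min (mx s (Z w)) (Z w 0))%:E + Vexp ((0, 1)%R :: s)
    = Vexp s + 1)%E.
  rewrite -(EZ 0) /Vexp -!ge0_integralD//; try by [apply/measurable_EFinP|
    move=> w _; rewrite lee_fin ?le_min ?mx_ge0 ?Z0].
  apply: eq_integral => w _; rewrite -!EFinD mx_cons /= divr1 maxC.
  by rewrite addrC addr_max_min.
have := tail_exceed s0; rewrite AE probability_setC// => tE.
rewrite -tE in minmax.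
rewrite -(fineK (Vexp_fin_num s0)) -(fineK (Vexp_fin_num s10)) in minmax.
have /fineK Pf : P3 [set w | rect s (Ytail w)] \is a fin_num by exact: fin_num_measure.
rewrite -Pf -!EFinB -!EFinD in minmax *.
case: minmax; rewrite -/(Vr s) -/(Vr ((0, 1) :: s)) => e; congr EFin.
by move: e; set a := fine _; set b := Vr _; set c := Vr _ => e; lra.
Qed.
Definition lawY : probability E R := law P3 mY.

Lemma lawY_inE : lawY (~` [set f | Defs.inE f]) = 0%E.
Proof.
have [N [mN N0 sub]] := pareto_gt1 mRp pareto.
apply: (subset_measure0 _ mN) => //.
- rewrite -[X in measurable X]setTI; apply: mY => //.
  by apply: measurableC; exact: measurable_inE.
- move=> w /= nY; apply: sub => /= R1; apply: nY => t.
  by rewrite mulr_ge0// ltW// (lt_trans ltr01).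
Qed.

Lemma lawY_rect_exceed s h : positive s ->
  lawY (rect s `&` [set f | 1 < (f h : R)]) =
  (Vr ((0, 1) :: s) - Vr s - (Vr ((0, 1) :: (h, 1) :: s) - Vr ((h, 1) :: s)))%:E.
Proof.
move=> s0.
have hs0 : positive ((h, 1) :: s).
  by move=> p; rewrite in_cons => /orP[/eqP->//|]; exact: s0.
have -> : rect s `&` [set f | 1 < (f h : R)] = rect s `\` [set f : E | f h <= 1].
  by apply/seteqP; split => f [fs] /= f1; split => //=; [apply/negP|move/negP: f1];
    rewrite -ltNge.
rewrite measureD//=; last 3 first.
- exact: measurable_rect.
- exact: measurable_coord_le.
- by apply: le_lt_trans (probability_le1 lawY (measurable_rect s)) _; rewrite ltry.
have -> : rect s `&` [set f : E | f h <= 1] = rect ((h, 1) :: s).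
  by rewrite rect_cons setIC.
rewrite EFinB; congr (_ - _)%E; exact: Y_rect.
Qed.

Lemma Vr_shift h s : positive s -> Vr (shift_seq h s) = Vr s.
Proof. by move=> s0; rewrite /Vr Vexp_shift. Qed.

(** It suffices to compare positive rectangles. On them the left side is V(0,s) - V(s) - V(0,h,s) +
    V(h,s), where 0 and h stand for unit constraints at these sites. This is symmetric in 0 and h,
    and the right side is the same expression with 0 and h exchanged, translated by -h. *)
Lemma lawY_time_change : time_change lawY.
Proof.
move=> h A mA; pose D t : set E := [set f : E | 1 < (f t : R)].
have mD t : measurable (D t) by exact: measurable_coord_gt.
have mB := @measurable_Bshift R d h.
pose m1 := mrestr lawY (mD h).
pose m2 := pushforward (mrestr lawY (mD (- h))) (Bshift h : E -> E).
have mC : measurable (~` [set f : E | Defs.inE f]).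
  by apply: measurableC; exact: measurable_inE.
have mlt t : (lawY (setT `&` D t) < +oo)%E.
  apply: le_lt_trans (probability_le1 lawY _) _; last by rewrite ltry.
  exact: measurableI.
apply: (@measure_rect_pos_unique R d m1 m2) => //.
- exact: mlt.
- exact: mlt.
- have : measurable (~` [set f : E | Defs.inE f] `&` D h) by exact: measurableI.
  move=> /(@subset_measure0 _ _ _ lawY) /(_ mC); apply; last exact: lawY_inE.
  by move=> f [].
- have : measurable (((Bshift h : E -> E) @^-1` (~` [set f : E | Defs.inE f])) `&` D (- h)).
    by apply: measurableI => //; rewrite -[X in measurable X]setTI; exact: mB.
  move=> /(@subset_measure0 _ _ _ lawY) /(_ mC); apply; last exact: lawY_inE.
  by move=> f [nf _] /= f0; apply: nf; exact: inE_Bshift.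
move=> s s0; rewrite /m1 /m2 /= /pushforward /mrestr.
rewrite lawY_rect_exceed//.
have -> : (Bshift h : E -> E) @^-1` rect s = rect (shift_seq (- h) s).
  apply/seteqP; split => f; rewrite [X in _ -> X]/=.
    by move=> ?; apply/rect_shift; rewrite opprK.
  by move/rect_shift; rewrite opprK.
rewrite lawY_rect_exceed; last exact: positive_shift.
have pcons t u : positive u -> positive ((t, 1) :: u).
  by move=> u0 p; rewrite in_cons => /orP[/eqP->//|]; exact: u0.
have e1 : (0, 1) :: shift_seq (- h) s = shift_seq (- h) ((h, 1) :: s).
  by rewrite /= subrr.
have e2 : (- h, 1) :: shift_seq (- h) s = shift_seq (- h) ((0, 1) :: s).
  by rewrite /= add0r.
have e3 : (0, 1) :: (- h, 1) :: shift_seq (- h) s =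
    shift_seq (- h) ((h, 1) :: (0, 1) :: s).
  by rewrite /= subrr add0r.
have ps1 t : positive ((t, 1) :: s) by exact: pcons.
have ps2 : positive ((h, 1) :: (0, 1) :: s) by exact: pcons (ps1 _).
rewrite e3 e1 e2 !Vr_shift//.
have -> : Vr ((h, 1) :: (0, 1) :: s) = Vr ((0, 1) :: (h, 1) :: s).
  rewrite /Vr /Vexp; congr fine; apply: eq_integral => w _; congr EFin.
  by rewrite !mx_cons maxCA.
by congr EFin; ring.
Qed.

(** The quotient Z(0)/Z(0) is 1 except where the weight Z(0) vanishes, so the probability is E[Z(0)]
    = 1. *)
Lemma Theta_at0 : {ae P3, forall w, Theta w 0 = 1}.
Proof.
pose A : set E := [set f | (f 0 : R) = 1].
have mA : measurable A.
  apply: sub_sigma_algebra; exists 0, [set 1 : R]; split => //; exact: measurable_set1.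
have PA : P3 [set w | A (Theta w)] = 1%E.
  rewrite ThetaZ// -(EZ 0); apply: eq_integral => w _; congr EFin.
  have [->|z0] := eqVneq (Z w 0) 0; first by rewrite mul0r.
  by rewrite indicE mem_set ?mulr1// /A /= divff.
have mT : measurable [set w | A (Theta w)].
  by rewrite -[X in measurable X]setTI; exact: mThetaE.
exists (~` [set w | A (Theta w)]); split => //; first exact: measurableC.
by rewrite probability_setC//= PA subee.
Qed.

End Spectral.

(** * Identities for the tail field *)

Lemma ae_law {d1 d2 : measure_display} {T : measurableType d1}
    {T' : measurableType d2} {R : realType} (P : probability T R)
    (F : T -> T') (mF : measurable_fun setT F) (Q : T' -> Prop) :
  measurable [set y | Q y] ->
  {ae P, forall x, Q (F x)} -> {ae law P mF, forall y, Q y}.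
Proof.
move=> mQ [N [mN N0 sub]]; exists (~` [set y | Q y]); split => //.
  exact: measurableC.
apply: (subset_measure0 _ mN) => //.
  by rewrite -[X in measurable X]setTI; apply: mF => //; exact: measurableC.
Qed.

Lemma ae_law_inv {d1 d2 : measure_display} {T : measurableType d1}
    {T' : measurableType d2} {R : realType} (P : probability T R)
    (F : T -> T') (mF : measurable_fun setT F) (Q : T' -> Prop) :
  {ae law P mF, forall y, Q y} -> {ae P, forall x, Q (F x)}.
Proof.
move=> [N [mN N0 sub]]; exists (F @^-1` N); split => //.
  by rewrite -[X in measurable X]setTI; exact: (mF measurableT).
by move=> x nQ; exact: sub.
Qed.

Lemma ae_countable {d1 : measure_display} {T : measurableType d1}
    {R : realType} {I : countType} (P : {measure set T -> \bar R})
    (Q : I -> T -> Prop) :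
  (forall i, {ae P, forall w, Q i w}) -> {ae P, forall w i, Q i w}.
Proof.
move=> H; pose F n := oapp (fun i => ~` [set w | Q i w]) set0 (pickle_inv n).
apply: (@negligibleS _ _ _ P (\bigcup_n F n)).
  move=> w /existsNP[i nQ]; exists (pickle i) => //.
  by rewrite /F pickleK_inv.
apply: negligible_bigcup => n; rewrite /F; case: pickle_inv => [i|] /=.
  exact: H.
exact: negligible_set0.
Qed.

Lemma ae_eq_measure {d1 : measure_display} {T : measurableType d1}
    {R : realType} (P : probability T R) (A B : set T) :
  measurable A -> measurable B -> {ae P, forall x, A x <-> B x} -> P A = P B.
Proof.
move=> mA mB AB; rewrite -[A]setIT -[B]setIT -!(integral_indic P measurableT)//.
apply: ge0_ae_eq_integral => //.
- by apply/measurable_EFinP; exact: measurable_indic.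
- by apply/measurable_EFinP; exact: measurable_indic.
- apply: filterS AB => x ABx _; rewrite !indicE; congr (_%:R%:E); congr nat_of_bool.
  by apply/idP/idP; rewrite !inE => /ABx.
Qed.

Section TailField.
Context {R : realType} {d : nat} {dT : measure_display} {T : measurableType dT}.
Context (ord : rel (Zd d)) (ordP : ti_total_order ord).
Context (P : probability T R) (Theta : T -> Zd d -> R) (Rp : T -> R).
Local Notation E := (fieldspace R d).
Context (mTheta : forall t, measurable_fun setT (fun w => Theta w t)).
Context (Theta0 : forall w t, 0 <= Theta w t).
Context (mRp : measurable_fun setT Rp).
Context (pareto : forall x : R, 1 <= x -> P [set w | x < Rp w] = (x^-1)%:E).
Context (indep : forall (B : set R) (A : set (Zd d -> R)), measurable B ->
  prodF A -> P [set w | B (Rp w) /\ A (Theta w)]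
    = (P [set w | B (Rp w)] * P [set w | A (Theta w)])%E).
Context (Theta1 : {ae P, forall w, Theta w 0 = 1}).
Local Notation Y := (Ytail Theta Rp).
Local Notation mThetaE := (mThetaE mTheta).
Local Notation mY := (mY mTheta mRp).
Local Notation lawY := (lawY P mTheta mRp).
Context (tc : time_change lawY).

Lemma ae_normalized : {ae P, forall w, 1 < Rp w /\ Theta w 0 = 1}.
Proof.
by apply: filterS2 (pareto_gt1 mRp pareto) Theta1 => w R1 t1; split.
Qed.

Lemma lawY_gt1 : {ae lawY, forall f : E, 1 < (f 0 : R)}.
Proof.
apply: ae_law; first exact: measurable_coord_gt.
by apply: filterS ae_normalized => w [R1 t1]; rewrite /Ytail t1 mulr1.
Qed.

Lemma lawY_ge0 : {ae lawY, forall f : E, Defs.inE f}.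
Proof.
apply: ae_law; first exact: measurable_inE.
apply: filterS ae_normalized => w [R1 _] t.
by rewrite /Ytail mulr_ge0// ltW// (lt_trans ltr01).
Qed.

(** Given Theta, the event Y(t) > 1 has probability min(Theta(t), 1), which is Theta(t) wherever [g]
    does not vanish; the identity follows by summing over t. *)
Lemma integral_BB_SS (g : E -> R) : measurable_fun setT g ->
  (forall f, 0 <= g f) -> (forall f, g f != 0 -> forall t, f t <= 1) ->
  (\int[P]_w ((g (Theta w))%:E * BB (Y w)) =
   \int[P]_w ((g (Theta w))%:E * SS (Theta w)))%E.
Proof.
move=> mg g0 g1.
have mgT : measurable_fun setT (fun w => (g (Theta w))%:E).
  by apply/measurable_EFinP; exact: (measurableT_comp mg mThetaE).
transitivity (\int[P]_w (\esum_(t in [set: Zd d]) ((g (Theta w))%:E * exc (Y w) t)))%E.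
  by apply: eq_integral => w _; rewrite esumZl// => t; exact: exc_ge0.
transitivity (\int[P]_w (\esum_(t in [set: Zd d])
    ((g (Theta w))%:E * (Num.min (Theta w t) 1)%:E)))%E.
  rewrite (@integral_esum R (Zd d) _ T P (fun t w => (g (Theta w))%:E * exc (Y w) t)%E).
  - rewrite (@integral_esum R (Zd d) _ T P
      (fun t w => (g (Theta w))%:E * (Num.min (Theta w t) 1)%:E)%E).
    + apply: eq_esum => t _.
      have mgE : measurable_fun setT (fun f : E => (g f)%:E) by exact/measurable_EFinP.
      (* [integral_pareto] asks for a factor that is nonnegative on the whole path space, hence the
         maximum with 0, which is then removed on [Theta]. *)
      have mm : measurable_fun setT (fun f : E => Num.max (f t) 0).
        by apply: measurable_maxr => //; exact: measurable_coord.
      have := @integral_pareto R _ _ T E P Theta Rp mThetaE mRp pareto indep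
        (fun f => (g f)%:E) (fun f => Num.max (f t) 0) mgE _ mm _.
      move=> /(_ (fun f => g0 f)) H; under eq_integral do rewrite /exc /Ytail.
      transitivity (\int[P]_w ((g (Theta w))%:E *
          (if (1 < Rp w * Num.max (Theta w t) 0)%R then 1 else 0)%:E))%E.
        by apply: eq_integral => w _; rewrite max_l.
      rewrite H; last by move=> f; rewrite le_max lexx orbT.
      by apply: eq_integral => w _; rewrite max_l.
    + move=> t; apply: emeasurable_funM => //; apply/measurable_EFinP.
      by apply: measurable_minr.
    + by move=> t w; rewrite mule_ge0// lee_fin ?g0// le_min Theta0 ler01.
  - move=> t; apply: emeasurable_funM => //.
    exact: (measurableT_comp (@measurable_exc R d t) mY).
  - by move=> t w; rewrite mule_ge0// ?exc_ge0// lee_fin.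
apply: eq_integral => w _; rewrite esumZl//; last first.
  by move=> t; rewrite lee_fin le_min Theta0 ler01.
have [->|gn0] := eqVneq (g (Theta w)) 0; first by rewrite !mul0e.
by congr (_ * _)%E; apply: eq_esum => t _; rewrite min_l// (g1 _ gn0).
Qed.

Lemma first_max_scale (f : Zd d -> R) (c : R) : 0 < c ->
  first_max ord (fun t => c * f t) <-> first_max ord f.
Proof.
move=> c0; have c_neq0 : c != 0 by rewrite gt_eqF.
split => H k; have [h1 h2] := H k; split.
- by rewrite ler_pM2l in h1.
- by move=> e; apply: h2; rewrite e.
- by rewrite ler_pM2l.
- by move=> /(mulfI c_neq0).
Qed.

Lemma YE w : Y w = (fun t => Rp w * Theta w t).
Proof. by []. Qed.

Lemma Y_ge0 w : 1 < Rp w -> Defs.inE (Y w).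
Proof. by move=> R1 t; rewrite mulr_ge0// ltW// (lt_trans ltr01). Qed.

Lemma Spos_Y_infty w : 1 < Rp w -> Spos (Y w) = +oo%E <-> SS (Theta w) = +oo%E.
Proof.
move=> R1; have R0 := lt_trans ltr01 R1.
rewrite SposE; last exact: Y_ge0.
have := SS_scale_lty (Theta0 w) R0; rewrite -YE.
have := SS_ge0 (Y_ge0 R1); have := SS_ge0 (Theta0 w).
case: (SS (Y w)) => [r| |]//; case: (SS (Theta w)) => [r'| |]// _ _ [H1 H2].
  by have := H1 (ltry _); rewrite ltxx.
by have := H2 (ltry _); rewrite ltxx.
Qed.

(** Expressed through [Spos] so that it is measurable and shift invariant without any condition on
    signs. *)
Definition Sinf : set E := [set f | Spos f = +oo%E].

Lemma measurable_Sinf : measurable Sinf.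
Proof.
have := @measurable_Spos R d measurableT [set +oo%E] (emeasurable_set1 _).
by rewrite setTI.
Qed.

Definition Qmax : set E := [set f | first_max ord f].

Lemma measurable_Qmax : measurable Qmax.
Proof. exact: measurable_first_max. Qed.

Lemma Sinf_Bshift h f : Sinf (Bshift h f) = Sinf f.
Proof. by rewrite /Sinf /= Spos_Bshift. Qed.

Lemma indic_Bshift (A : set E) : (forall h f, A (Bshift h f) = A f) ->
  forall h f, \1_A (Bshift h f) = \1_A f :> R.
Proof.
by move=> H h f; rewrite !indicE; congr (nat_of_bool _)%:R; apply/idP/idP;
  rewrite !inE H.
Qed.

Lemma eq_indic (A B : set E) f g : (A f <-> B g) -> \1_A f = \1_B g :> R.
Proof.
by move=> H; rewrite !indicE; congr (nat_of_bool _)%:R; apply/idP/idP;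
  rewrite !inE => /H.
Qed.

(** The weight and [Qmax] do not distinguish Y from Theta, so the mass sent is a function of Theta
    times B(Y); there [integral_BB_SS] replaces B(Y) by S(Theta). *)
Lemma Qmax_transport (w : E -> R) : measurable_fun setT w ->
  (forall f, 0 <= w f) -> (forall x, 1 < Rp x -> w (Y x) = w (Theta x)) ->
  (\int[lawY]_f ((w f * \1_Qmax f)%:E * BB f) =
   \int[P]_x ((w (Theta x) * \1_Qmax (Theta x))%:E * SS (Theta x)))%E.
Proof.
move=> mw w0 hom.
pose C : set E := [set f | forall t, f t <= 1].
have mC : measurable C.
  rewrite (_ : C = \bigcap_t [set f : E | f t <= 1]).
    by apply: measurable_bigcap_countable => t _; exact: measurable_coord_le.
  by apply/seteqP; split => f H t; [move=> _; exact: H|exact: (H t Logic.I)].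
have mQ : measurable_fun [set: E] (\1_Qmax : E -> R).
  exact: measurable_indic measurable_Qmax.
have mwQ : measurable_fun setT (fun f : E => w f * \1_Qmax f).
  exact: measurable_funM.
(* [\1_C] enforces the bound by 1 that [integral_BB_SS] demands of every field. At [Theta] it
   changes nothing: on [Qmax] all values are at most Theta(0) = 1. *)
pose g (f : E) : R := w f * \1_Qmax f * \1_C f.
have mg : measurable_fun setT g.
  by apply: measurable_funM => //; exact: measurable_indic.
have g0 f : 0 <= g f by rewrite !mulr_ge0.
have g1 f : g f != 0 -> forall t, f t <= 1.
  have [Cf //|nC] := pselect (C f).
  have c0 : \1_C f = 0 :> R by rewrite indicE memNset.
  by rewrite /g c0 mulr0 eqxx.
have mSS : measurable_fun setT (fun x => SS (Theta x)).
  rewrite (_ : (fun x => _) = (fun x => Spos (Theta x))); last first.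
    by apply/funext => x; rewrite SposE.
  exact: (measurableT_comp (@measurable_Spos R d) mThetaE).
have mBY : measurable_fun setT (fun x => BB (Y x)).
  exact: (measurableT_comp (@measurable_BB R d) mY).
have mgT : measurable_fun setT (fun x => (g (Theta x))%:E).
  by apply/measurable_EFinP; exact: (measurableT_comp mg mThetaE).
have gT x : Theta x 0 = 1 -> g (Theta x) = w (Theta x) * \1_Qmax (Theta x).
  move=> t1; rewrite /g; have [Qx|Qx] := boolP (Theta x \in Qmax); last first.
    have q0 : \1_Qmax (Theta x) = 0 :> R by rewrite indicE (negbTE Qx).
    by rewrite q0 mulr0 mul0r.
  have c1 : \1_C (Theta x) = 1 :> R.
    rewrite indicE mem_set// => t; move: Qx; rewrite inE => /(_ t)[+ _].
    by rewrite t1.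
  by rewrite c1 mulr1.
transitivity (\int[P]_x ((g (Theta x))%:E * BB (Y x)))%E.
  rewrite ge0_integral_law; last 2 first.
  - apply: emeasurable_funM; last exact: measurable_BB.
    exact/measurable_EFinP.
  - by move=> f; rewrite mule_ge0// ?BB_ge0// lee_fin mulr_ge0.
  apply: ge0_ae_eq_integral => //.
  - apply: emeasurable_funM => //.
    by apply/measurable_EFinP; exact: (measurableT_comp mwQ mY).
  - exact: emeasurable_funM.
  - by move=> x _; rewrite mule_ge0// ?BB_ge0// lee_fin mulr_ge0.
  - by move=> x _; rewrite mule_ge0// ?BB_ge0// lee_fin.
  apply: filterS ae_normalized => x [R1 t1] _; congr (_ * _)%E; congr EFin.
  rewrite gT// hom//; congr (_ * _).
  by apply: eq_indic; apply: first_max_scale; exact: lt_trans ltr01 R1.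
rewrite integral_BB_SS//; apply: ge0_ae_eq_integral => //.
- exact: emeasurable_funM.
- apply: emeasurable_funM => //.
  by apply/measurable_EFinP; exact: (measurableT_comp mwQ mThetaE).
- by move=> x _; rewrite mule_ge0// ?SS_ge0// lee_fin.
- by move=> x _; rewrite mule_ge0// ?SS_ge0// lee_fin mulr_ge0.
- by apply: filterS Theta1 => x t1 _; rewrite gT.
Qed.

(** For the weight [\1_Sinf] the mass sent is infinity times a probability and the mass received at
    most 1, so both vanish: on [Sinf] almost surely no exceedance is a first maximum. But a finite
    nonempty set of exceedances contains one. *)
Lemma ae_BB_Sinf : {ae lawY, forall f : E, (BB f < +oo)%E -> ~ Sinf f}.
Proof.
have mw : measurable_fun [set: E] (\1_Sinf : E -> R).
  exact: measurable_indic measurable_Sinf.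
have mH := measurable_hits measurable_Qmax.
have w0 (f : E) : 0 <= \1_Sinf f :> R by [].
have := selector_transport tc measurable_Qmax (first_max_selector ordP) mw w0
  (indic_Bshift Sinf_Bshift).
set I1 := (X in X = _); set I2 := (X in _ = X) => e12.
pose A := [set w | (Sinf `&` Qmax) (Theta w)].
have mA : measurable A.
  rewrite -[X in measurable X]setTI; apply: mThetaE => //; apply: measurableI.
    exact: measurable_Sinf.
  exact: measurable_Qmax.
have I1E : I1 = (+oo * P A)%E.
  rewrite -(integral_cst P mA) [RHS]integral_mkcond /I1 Qmax_transport//.
    apply: eq_integral => w _.
    have -> : \1_Sinf (Theta w) * \1_Qmax (Theta w) = \1_A w :> R.
      rewrite -[LHS]/((\1_Sinf \* \1_Qmax) (Theta w)) -indicI !indicE.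
      by congr (nat_of_bool _)%:R; apply/idP/idP; rewrite !inE.
    rewrite patchE indicE; case: ifPn; rewrite ?mul0e// mul1e inE => -[+ _].
    by rewrite /Sinf /= SposE.
  move=> x R1; apply: eq_indic; rewrite /Sinf /= [in X in _ <-> X]SposE//.
  exact: Spos_Y_infty.
have I2le : (I2 <= 1)%E.
  apply: probability_integral_le1.
    apply/measurable_EFinP; apply: measurable_funM => //; exact: measurable_indic.
  move=> f; rewrite !lee_fin !indicE.
  by do 2 case: (_ \in _); rewrite ?(mulr0,mul0r,mulr1,lexx,ler01).
have PA : P A = 0%E.
  have : (0 <= P A)%E by [].
  rewrite le_eqVlt => /orP[/eqP <-//|A0]; move: I2le.
  by rewrite -e12 I1E gt0_mulye.
have I20 : I2 = 0%E by rewrite -e12 I1E PA mule0.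
have mSH : measurable (Sinf `&` hits Qmax).
  by apply: measurableI => //; exact: measurable_Sinf.
have L0 : lawY (Sinf `&` hits Qmax) = 0%E.
  rewrite -I20 -[X in lawY X]setIT -integral_indic//; apply: eq_integral => f _.
  by rewrite indicI.
have aeL : {ae lawY, forall f, ~ (Sinf `&` hits Qmax) f}.
  by exists (Sinf `&` hits Qmax); split => // f /= /contrapT.
apply: filterS2 lawY_gt1 aeL => f f1 nSH By Sf; apply: nSH; split => //.
have [j Qj fj] := exists_first_max ordP (BB_lty_finite By) f1.
by exists j.
Qed.

Lemma measurable_Ypre (A : set E) : measurable A -> measurable [set w | A (Y w)].
Proof. by move=> mA; rewrite -[X in measurable X]setTI; exact: mY. Qed.

Lemma measurable_Thetapre (A : set E) : measurable A ->
  measurable [set w | A (Theta w)].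
Proof. by move=> mA; rewrite -[X in measurable X]setTI; exact: mThetaE. Qed.

Lemma SinfN (f : Zd d -> R) : Defs.inE f -> (SS f < +oo)%E <-> ~ Sinf f.
Proof.
move=> f0; rewrite /Sinf /= SposE// ltey; split; first by move/eqP.
by move=> H; apply/eqP.
Qed.

(* On the null event [Rp < 0] the field [Y] is nonpositive and [esum] is the
   supremum of its finite partial sums, so the equivalence holds surely. *)
Lemma SS_Y_lty w : (SS (Y w) < +oo)%E <-> ~ Sinf (Y w).
Proof.
have [R0|R0] := leP 0 (Rp w); first by apply: SinfN => t; rewrite mulr_ge0.
have Yle t : Y w t <= 0 by apply: mulr_le0_ge0 => //; exact: ltW.
split => _.
  rewrite /Sinf /= /Spos esum1// => t _; by rewrite max_r.
apply: (@le_lt_trans _ _ 0%E) => //.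
rewrite -(@esum1 R (Zd d) setT (fun=> 0%E))//.
by apply: le_esum => t _; rewrite lee_fin.
Qed.

Definition EinvB : \bar R := (\int[P]_w ediv 1 (BB (Y w)))%E.

(** Selectors built from anchoring maps are controlled where S < oo, whereas the transport formula
    asks for a hit where B < oo; [ae_BB_Sinf] bridges the two. *)
Lemma anchor_lawY (Q : set E) : measurable Q -> selector Q ->
  {ae lawY, forall f : E, ~ Sinf f -> hits Q f} -> lawY Q = EinvB.
Proof.
move=> mQ sQ hQ; rewrite (anchor_probability tc mQ sQ lawY_gt1); last first.
  by apply: filterS2 ae_BB_Sinf hQ => f BS H By; exact/H/BS.
rewrite ge0_integral_law//.
  by apply: measurable_ediv => //; exact: measurable_BB.
move=> f; rewrite /ediv; have := BB_ge0 f; case: (BB f) => // r r0.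
by case: ifP => // _; rewrite mul1e lee_fin invr_ge0.
Qed.

Lemma selector_sub (Q Q' : set E) : Q' `<=` Q -> selector Q -> selector Q'.
Proof. by move=> sub sQ f j k /sub Qj /sub Qk; exact: sQ Qj Qk. Qed.

Lemma hits_Sinf (Q : set E) f : hits Q f -> ~ Sinf f -> hits (Q `&` ~` Sinf) f.
Proof.
by move=> [j Qj fj] Sf; exists j => //; split => //=; rewrite Sinf_Bshift.
Qed.

Lemma lawY_finite : {ae lawY, forall f : E, ~ Sinf f -> (BB f < +oo)%E}.
Proof.
have H (f : E) : Defs.inE f -> ~ Sinf f -> (BB f < +oo)%E.
  by move=> f0 Sf; apply: le_lt_trans (BB_le_SS f0) _; exact/SinfN.
exact: filterS H lawY_ge0.
Qed.

(** The event carries no summability condition; it is the form to which the extremal index is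
    compared, while [I_fe] includes S < oo. *)
Lemma lawY_first_exceed : lawY [set f | first_exceed ord f] = EinvB.
Proof.
apply: anchor_lawY.
- exact: measurable_first_exceed.
- exact: first_exceed_selector.
- apply: filterS2 lawY_gt1 lawY_finite => f f1 By /By /BB_lty_finite fin.
  have [j Qj fj] := exists_first_exceed ordP fin f1.
  by exists j.
Qed.

Lemma prob_I_fe : P [set w | I_fe ord (Y w) = Some 0] = EinvB.
Proof.
rewrite -(@anchor_lawY ([set f | first_exceed ord f] `&` ~` Sinf)).
- congr (P _); apply/seteqP; split => w /=.
    (* For negative [Rp] the field has no exceedance, so [I_fe] cannot return a site. *)
    have [R0|R0] := leP 0 (Rp w).
      have Y0 : Defs.inE (Y w) by move=> t; rewrite mulr_ge0.
      by move=> H; have [fe /SS_Y_lty Sf] := (I_fe0P ordP Y0).1 H; split.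
    rewrite /I_fe; case: pselect => // -[_ s1] _.
    have /ereal_sup_gt[_ [t _ <-]] := s1.
    rewrite lte_fin => /(lt_trans ltr01); rewrite ltNge mulr_le0_ge0//.
    exact: ltW.
  move=> [[f1 fe] Sf]; apply/I_fe0P => //; last by split => //; exact/SS_Y_lty.
  move=> t; rewrite mulr_ge0// leNgt; apply/negP => R0.
  have := lt_trans ltr01 f1; rewrite ltNge mulr_le0_ge0//.
  exact: ltW.
- apply: measurableI; first exact: measurable_first_exceed.
  by apply: measurableC; exact: measurable_Sinf.
- exact: selector_sub (@subIsetl _ _ _) (first_exceed_selector ordP).
- apply: filterS2 lawY_gt1 lawY_finite => f f1 By Sf; apply: hits_Sinf => //.
  have [j Qj fj] := exists_first_exceed ordP (BB_lty_finite (By Sf)) f1.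
  by exists j.
Qed.

(** Invariant under positive scaling, hence the same condition on Y and on Theta; at Theta it is the
    event I_A = 0 up to the almost sure condition Theta(0) > 0. *)
Definition QA : set E := Qmax `&` ~` Sinf.

Lemma measurable_QA : measurable QA.
Proof.
apply: measurableI; first exact: measurable_Qmax.
by apply: measurableC; exact: measurable_Sinf.
Qed.

Lemma QA_scale w : 1 < Rp w -> QA (Theta w) <-> QA (Y w).
Proof.
move=> R1; have R0 := lt_trans ltr01 R1.
have e1 : Qmax (Theta w) <-> Qmax (Y w) by apply: iff_sym; exact: first_max_scale.
have e2 : Sinf (Theta w) <-> Sinf (Y w).
  by rewrite /Sinf /= SposE//; apply: iff_sym; exact: Spos_Y_infty.
by split=> -[q s]; split; [exact/e1|move=> /e2|exact/e1|move=> /e2].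
Qed.

Lemma lawY_QA : lawY QA = EinvB.
Proof.
apply: anchor_lawY; first exact: measurable_QA.
- exact: selector_sub (@subIsetl _ _ _) (first_max_selector ordP).
- apply: filterS2 lawY_gt1 lawY_finite => f f1 By Sf; apply: hits_Sinf => //.
  have [j Qj fj] := exists_first_max ordP (BB_lty_finite (By Sf)) f1.
  by exists j.
Qed.

Lemma prob_QA : P [set w | QA (Theta w)] = EinvB.
Proof.
rewrite -lawY_QA; apply: ae_eq_measure.
- exact: measurable_Thetapre measurable_QA.
- exact: measurable_Ypre measurable_QA.
- by apply: filterS ae_normalized => w [R1 _]; exact: QA_scale.
Qed.

Lemma prob_I_A : P [set w | I_A ord (Theta w) = Some 0] = EinvB.
Proof.
rewrite -prob_QA.
have -> : [set w | I_A ord (Theta w) = Some 0] =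
    [set w | (QA `&` [set f : E | 0 < (f 0 : R)]) (Theta w)].
  apply/seteqP; split => w /=.
    move=> H; have [fm t0 /(SinfN (Theta0 w)) S] := (I_A0P ordP (Theta0 w)).1 H.
    by split=> //; split.
  move=> [[fm S] t0]; apply: (I_A0P ordP (Theta0 w)).2; split => //.
  exact: (SinfN (Theta0 w)).2.
apply: ae_eq_measure.
- apply: measurable_Thetapre; apply: measurableI; first exact: measurable_QA.
  exact: measurable_coord_gt.
- exact: measurable_Thetapre measurable_QA.
- by apply: filterS Theta1 => w t1; split => [[]//|q]; split=> //=; rewrite t1.
Qed.

Lemma prob_exceed t (c : R) : 0 <= c ->
  P [set w | 1 < Rp w * (c * Theta w t)] =
  (\int[P]_w (Num.min (c * Theta w t) 1)%:E)%E.
Proof.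
move=> c0.
have mm : measurable_fun setT (fun f : E => c * Num.max (f t) 0).
  apply: measurable_funM => //; apply: measurable_maxr => //.
  exact: measurable_coord.
have mA : measurable [set w | 1 < Rp w * (c * Theta w t)].
  have mm' : measurable_fun setT (fun w => Rp w * (c * Theta w t)).
    by apply: measurable_funM => //; exact: measurable_funM.
  have := mm' measurableT `]1, +oo[%classic; rewrite setTI.
  rewrite (_ : _ @^-1` _ = [set w | 1 < Rp w * (c * Theta w t)]); first exact.
  by apply/seteqP; split => w /=; rewrite in_itv/= andbT.
rewrite -[X in P X]setIT -integral_indic//.
have := @integral_pareto R _ _ T E P Theta Rp mThetaE mRp pareto indep
  (fun=> 1%E) (fun f => c * Num.max (f t) 0).
move=> /(_ (measurable_cst _) (fun=> lee01) mm) H.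
transitivity (\int[P]_w (1 * (if (1 < Rp w * (c * Num.max (Theta w t) 0))%R
    then 1 else 0)%:E)%E)%E.
  apply: eq_integral => w _; rewrite max_l// mul1e indicE; case: ifPn => h.
    by rewrite mem_set.
  by rewrite memNset//; exact/negP.
rewrite H; last by move=> f; rewrite mulr_ge0// le_max lexx orbT.
by apply: eq_integral => w _; rewrite mul1e max_l.
Qed.

(** The events Y(t) = 1 and Y(t) > 1 are disjoint and both imply (1 + e) Y(t) > 1. By [prob_exceed]
    the last event exceeds the second in probability by at most e, because min((1 + e) x, 1) <=
    min(x, 1) + e. *)
Lemma Y_neq1 t : P [set w | Y w t = 1] = 0%E.
Proof.
have mYt : measurable_fun setT (fun w => Y w t) by exact: measurable_funM.
have mA : measurable [set w | Y w t = 1].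
  rewrite (_ : [set _ | _] = (fun w => Y w t) @^-1` [set 1])//.
  by rewrite -[X in measurable X]setTI; exact: mYt.
have mC c : measurable [set w | 1 < Rp w * (c * Theta w t)].
  have mm' : measurable_fun setT (fun w => Rp w * (c * Theta w t)).
    by apply: measurable_funM => //; exact: measurable_funM.
  have := mm' measurableT `]1, +oo[%classic; rewrite setTI.
  rewrite (_ : _ @^-1` _ = [set w | 1 < Rp w * (c * Theta w t)]); first exact.
  by apply/seteqP; split => w /=; rewrite in_itv/= andbT.
set A := [set w | Y w t = 1].
pose B c := [set w | 1 < Rp w * (c * Theta w t)].
suff H e : 0 < e -> (P A <= e%:E)%E.
  apply/le_anti; rewrite measure_ge0 andbT; apply/lee_addgt0Pr => e e0.
  by rewrite add0e; exact: H.
move=> e0; have c0 : 0 <= 1 + e by rewrite addr_ge0// ltW.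
have mB c : measurable (B c) by exact: mC.
have PB1 : (P (B 1%R) \is a fin_num) by exact: fin_num_measure.
have h1 : (P A + P (B 1%R) <= P (B (1 + e)%R))%E.
  rewrite -measureU//; last first.
    apply/seteqP; split => w //= -[]; rewrite /A /B /= mul1r /Ytail => ->.
    by rewrite ltxx.
  apply: le_measure; rewrite ?inE//; first exact: measurableU.
  move=> w; rewrite /A /B /= mul1r mulrCA /Ytail => -[->|Y1]; first by rewrite mulr1 ltrDl.
  by rewrite (lt_le_trans Y1)// ler_peMl ?lerDl ?ltW// (lt_trans ltr01).
have h2 : (P (B (1 + e)%R) <= P (B 1%R) + e%:E)%E.
  rewrite /B !prob_exceed//.
  have mmin c : measurable_fun setT (fun w => (Num.min (c * Theta w t) 1)%:E).
    by apply/measurable_EFinP; apply: measurable_minr => //; exact: measurable_funM.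
  have -> : e%:E = (\int[P]_w (cst e%:E w))%E.
    by rewrite (integral_cst P measurableT) [X in (_ * X)%E]probability_setT mule1.
  rewrite -ge0_integralD//; last 2 first.
  - by move=> w _; rewrite lee_fin le_min ler01 mul1r Theta0.
  - by move=> w _; rewrite lee_fin ltW.
  apply: ge0_le_integral => //.
  - by move=> w _; rewrite lee_fin le_min ler01 mulr_ge0.
  - by apply: emeasurable_funD.
  move=> w _; rewrite -EFinD lee_fin mul1r.
  have [t1|t1] := leP (Theta w t) 1; last first.
    by rewrite ge_min lerDl (ltW e0) orbT.
  by rewrite ge_min mulrDl mul1r lerD2l ler_piMr// ltW.
have := le_trans h1 h2; rewrite addeC leeD2lE//.
Qed.

(** * Anchoring maps as selectors *)

Section Anchoring.
Context (I : (Zd d -> R) -> option (Zd d)) (anchI : anchoring I).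
Context (I_defined : P [set w | I (Y w) <> None /\ (SS (Y w) < +oo)%E]
  = P [set w | (SS (Y w) < +oo)%E]).

Lemma measurable_I j : measurable [set f : E | I f = j].
Proof. by case: anchI => /(_ j). Qed.

Lemma measurable_Inone : measurable [set f : E | I f <> None].
Proof. by apply: measurableC; exact: measurable_I. Qed.

Lemma ae_I_defined : {ae P, forall w, ~ Sinf (Y w) -> I (Y w) <> None}.
Proof.
pose A : set E := ~` Sinf; pose B : set E := [set f | I f <> None] `&` ~` Sinf.
have mA : measurable A by apply: measurableC; exact: measurable_Sinf.
have mB : measurable B by apply: measurableI => //; exact: measurable_Inone.
have AE : [set w | (SS (Y w) < +oo)%E] = [set w | A (Y w)].
  by apply/seteqP; split => w /SS_Y_lty.
have BE : [set w | I (Y w) <> None /\ (SS (Y w) < +oo)%E] = [set w | B (Y w)].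
  by apply/seteqP; split => w /= [Iw /SS_Y_lty Sw]; split.
have AB : P [set w | B (Y w)] = P [set w | A (Y w)] by rewrite -AE -BE.
exists ([set w | A (Y w)] `\` [set w | B (Y w)]); split => //.
- by apply: measurableD; exact: measurable_Ypre.
- rewrite measureD; [|exact: measurable_Ypre|exact: measurable_Ypre|]; last first.
    by apply: le_lt_trans (probability_le1 P (measurable_Ypre mA)) _; rewrite ltry.
  rewrite setIidr; last by move=> w [].
  transitivity (P [set w | A (Y w)] - P [set w | A (Y w)])%E.
    by congr (_ - _)%E; exact: AB.
  by rewrite subee//; apply: fin_num_measure; exact: measurable_Ypre.
- move=> w /= /not_implyP[Sw Iw]; split => // -[Jw _]; exact: Iw.
Qed.

Lemma prob_I : P [set w | I (Y w) = Some 0 /\ (SS (Y w) < +oo)%E] = EinvB.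
Proof.
(* Nonnegativity is part of [Q] because the anchoring axioms speak of nonnegative fields only. *)
pose Q : set E := ([set f | I f = Some 0] `&` [set f | Defs.inE f]) `&` ~` Sinf.
have mQ : measurable Q.
  apply: measurableI; last by apply: measurableC; exact: measurable_Sinf.
  by apply: measurableI; [exact: measurable_I|exact: measurable_inE].
have nS (k : Zd d) : Some k <> None by [].
have IB (f : E) i : Defs.inE f -> I f <> None ->
    I f = omap (fun k => k - i) (I (Bshift i f)).
  by move=> f0 If; case: anchI => _ /(_ f f0 If)[_].
rewrite -(@anchor_lawY Q) //.
- apply: ae_eq_measure.
  + rewrite (_ : [set _ | _] = [set w | ([set f | I f = Some 0] `&` ~` Sinf) (Y w)]).
      apply: measurable_Ypre; apply: measurableI; first exact: measurable_I.
      by apply: measurableC; exact: measurable_Sinf.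
    by apply/seteqP; split => w /= [Iw /SS_Y_lty Sw]; split.
  + exact: measurable_Ypre.
  + apply: filterS ae_normalized => w [R1 _]; split.
      by move=> [Iw /SS_Y_lty Sw]; split=> //; split=> //; exact: Y_ge0.
    by move=> [[Iw _] /SS_Y_lty Sw]; split.
(* The fields viewed from [j] and from [k] differ by the shift [j - k]. Equivariance moves the
   anchor by the same amount, and both anchors are 0, so [j = k]. *)
- move=> f j k [[Ij fj0] _] [[Ik _] _].
  have := IB _ (j - k) fj0; rewrite Ij => /(_ (nS _)); rewrite BshiftD.
  rewrite addrAC subrr add0r Ik /= => -[] /esym/eqP.
  by rewrite sub0r oppr_eq0 subr_eq0 => /eqP.
- have aeI : {ae lawY, forall f : E, ~ Sinf f -> I f <> None}.
    apply: ae_law; last exact: ae_I_defined.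
    rewrite (_ : [set _ | _] = Sinf `|` [set f : E | I f <> None]).
      by apply: measurableU; [exact: measurable_Sinf|exact: measurable_Inone].
    apply/seteqP; split => f /= H; first by have [Sf|/H] := pselect (Sinf f); [left|right].
    by case: H.
  have ae1 : {ae lawY, forall f : E, forall j, f j <> 1}.
    have mN j : measurable [set f : E | (f j : R) = 1].
      by apply: sub_sigma_algebra; exists j, [set 1 : R]; split.
    apply: ae_law.
      rewrite (_ : [set _ | _] = \bigcap_j ~` [set f : E | (f j : R) = 1]).
        by apply: measurable_bigcap_countable => j _; exact: measurableC.
      by apply/seteqP; split => f H j; [move=> _; exact: H|exact: (H j Logic.I)].
    apply: ae_countable => j; exists [set w | Y w j = 1]; split.
    + exact: measurable_Ypre (mN j).
    + exact: Y_neq1.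
    + by move=> w /contrapT.
  apply: filterS2 (filterI aeI ae1) (filterI lawY_gt1 lawY_ge0).
  move=> f [fI fn1] [f1 f0] Sf; have If := fI Sf.
  case Ij : (I f) If => [j|//] _.
  have [/(_ j Ij) fj _] : (forall i, I f = Some i -> Num.min (f 0) 1 <= f i) /\
     (forall i, I f = omap (fun k => k - i) (I (Bshift i f))).
    by case: anchI => _ /(_ f f0); rewrite Ij; exact.
  (* Since f(0) > 1, the anchor satisfies f(j) >= min(f(0), 1) = 1, and equality is excluded almost
     surely. *)
  exists j; last first.
    rewrite lt_neqAle eq_sym; apply/andP; split; first exact/eqP.
    by rewrite (min_r (ltW f1)) in fj.
  split; last by rewrite /= Sinf_Bshift.
  split; last exact: inE_Bshift.
  change (I (Bshift (- j) f) = Some 0).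
  have := IB f (- j) f0; rewrite Ij => /(_ (nS _)).
  case: (I (Bshift (- j) f)) => //= k [] /eqP.
  by rewrite opprK -[X in X == _]add0r => /eqP/addIr <-.
Qed.

Lemma prob_I_Theta : zero_homogeneous I ->
  P [set w | I (Theta w) = Some 0 /\ (SS (Theta w) < +oo)%E] = EinvB.
Proof.
move=> hom; rewrite -prob_I.
pose Q : set E := [set f | I f = Some 0] `&` ~` Sinf.
have mQ : measurable Q.
  apply: measurableI; first exact: measurable_I.
  by apply: measurableC; exact: measurable_Sinf.
rewrite (_ : [set w | I (Theta w) = _ /\ _] = [set w | Q (Theta w)]); last first.
  by apply/seteqP; split => w /= [Iw /(SinfN (Theta0 w)) Sw]; split.
rewrite (_ : [set w | I (Y w) = _ /\ _] = [set w | Q (Y w)]); last first.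
  by apply/seteqP; split => w /= [Iw /SS_Y_lty Sw]; split.
apply: ae_eq_measure; [exact: measurable_Thetapre|exact: measurable_Ypre|].
apply: filterS ae_normalized => w [R1 _]; have R0 := lt_trans ltr01 R1.
have e : I (Y w) = I (Theta w) by rewrite YE hom.
have e2 : Sinf (Theta w) <-> Sinf (Y w).
  by rewrite /Sinf /= SposE//; apply: iff_sym; exact: Spos_Y_infty.
by rewrite /Q /= e; split=> -[-> S]; split => // /e2.
Qed.

End Anchoring.

Lemma BB_SS_negligible :
  P.-negligible [set w | ~ ((BB (Y w) < +oo)%E <-> (SS (Y w) < +oo)%E)].
Proof.
have : {ae P, forall w, (BB (Y w) < +oo)%E <-> (SS (Y w) < +oo)%E}.
  apply: filterS2 (ae_law_inv ae_BB_Sinf) ae_normalized => w BS [R1 _]; split.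
    by move=> /BS ?; exact/SS_Y_lty.
  by apply: le_lt_trans; apply: BB_le_SS; exact: Y_ge0.
by [].
Qed.

Lemma supf_le_SS (f : Zd d -> R) : Defs.inE f -> (supf f <= SS f)%E.
Proof. by move=> f0; apply: ge_ereal_sup => _ [t _ <-]; exact: SS_ge. Qed.

(** Transport with weight sup/sum to the first maximum. The mass received has mean E[sup/sum]: if S
    < oo a first maximum exists and is an exceedance, otherwise the weight is 0. The mass sent is
    weight times S(Theta) on [Qmax], where the supremum is Theta(0) = 1, so it is the indicator of
    [QA]. *)
Lemma expect_sup_over_sum :
  (\int[P]_w ediv (supf (Theta w)) (SS (Theta w)))%E = EinvB.
Proof.
pose W (f : E) := ediv (maxe 0%E (supf f)) (Spos f).
pose w (f : E) : R := fine (W f).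
have W0 f : (0 <= W f)%E by rewrite ediv_ge0 ?Spos_ge0// le_max lexx.
have mW : measurable_fun setT W.
  apply: measurable_ediv; last exact: measurable_Spos.
  by apply: measurable_maxe => //; exact: measurable_supf.
have mw : measurable_fun setT w.
  exact: (measurableT_comp (fine_measurable measurableT) mW).
have w0 f : 0 <= w f by rewrite /w fine_ge0.
have wB h f : w (Bshift h f) = w f by rewrite /w /W supf_Bshift Spos_Bshift.
have WE f : Defs.inE f -> W f = ediv (supf f) (SS f).
  by move=> f0; rewrite /W SposE// max_r// supf_ge0.
have wE f : Defs.inE f -> (w f)%:E = ediv (supf f) (SS f).
  move=> f0; rewrite /w WE// fineK// /ediv; have := supf_le_SS f0.
  have := supf_ge0 f0; case: (SS f) => // r s0 sr; case: ifP => // _.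
  rewrite fin_numM//; apply/fin_numP; split; apply/eqP => e.
    by rewrite e in s0.
  by rewrite e in sr.
have hom x : 1 < Rp x -> w (Y x) = w (Theta x).
  move=> R1; have R0 := lt_trans ltr01 R1.
  rewrite /w !WE//; last exact: Y_ge0.
  by rewrite YE ediv_supf_SS_scale.
have := selector_transport tc measurable_Qmax (first_max_selector ordP) mw w0 wB.
rewrite Qmax_transport// => e.
have mH := measurable_hits measurable_Qmax.
have mwH : measurable_fun setT (fun f : E => w f * \1_(hits Qmax) f).
  by apply: measurable_funM => //; exact: measurable_indic.
transitivity (\int[lawY]_f (w f * \1_(hits Qmax) f)%:E)%E.
  have mwHE : measurable_fun setT (fun f : E => (w f * \1_(hits Qmax) f)%:E).
    exact/measurable_EFinP.
  have wH0 (f : E) : (0 <= (w f * \1_(hits Qmax) f)%:E)%E.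
    by rewrite lee_fin mulr_ge0.
  rewrite (ge0_integral_law P mY mwHE wH0).
  under eq_integral do rewrite -wE//.
  apply: ge0_ae_eq_integral => //.
  - by apply/measurable_EFinP; exact: (measurableT_comp mw mThetaE).
  - by apply/measurable_EFinP; exact: (measurableT_comp mwH mY).
  - by move=> x _; rewrite lee_fin.
  apply: filterS2 ae_normalized (ae_law_inv lawY_finite) => x [R1 t1] BS _.
  have [Sx|Sx] := pselect (Sinf (Y x)); last first.
    have Y1 : 1 < Y x 0 by rewrite /Ytail t1 mulr1.
    have [j Qj fj] := exists_first_max ordP (BB_lty_finite (BS Sx)) Y1.
    by rewrite hom// indicE mem_set ?mulr1//; exists j.
  have -> : w (Theta x) = 0.
    rewrite -hom// /w /W; move: Sx; rewrite /Sinf /= => ->.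
    by [].
  by rewrite (_ : w (Y x) = 0) ?mul0r// /w /W; move: Sx; rewrite /Sinf /= => ->.
rewrite -e -prob_QA -[X in P X]setIT -integral_indic//; last first.
  exact: measurable_Thetapre measurable_QA.
have mQ : measurable_fun [set: E] (\1_Qmax : E -> R).
  exact: measurable_indic measurable_Qmax.
have mwQ : measurable_fun setT (fun f : E => w f * \1_Qmax f).
  exact: measurable_funM.
have mSS : measurable_fun setT (fun x => SS (Theta x)).
  rewrite (_ : (fun x => _) = (fun x => Spos (Theta x))); last first.
    by apply/funext => x; rewrite SposE.
  exact: (measurableT_comp (@measurable_Spos R d) mThetaE).
apply: ge0_ae_eq_integral => //.
- apply: emeasurable_funM => //.
  by apply/measurable_EFinP; exact: (measurableT_comp mwQ mThetaE).
- apply/measurable_EFinP; apply: measurable_indic.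
  exact: measurable_Thetapre measurable_QA.
- by move=> x _; rewrite mule_ge0// ?SS_ge0// lee_fin mulr_ge0.
apply: filterS Theta1 => x t1 _.
have [Qx|Qx] := pselect (Qmax (Theta x)); last first.
  have q0 : \1_Qmax (Theta x) = 0 :> R by rewrite indicE memNset.
  by rewrite q0 mulr0 mul0e indicE memNset//= => -[].
have q1 : \1_Qmax (Theta x) = 1 :> R by rewrite indicE mem_set.
rewrite q1 mulr1 wE// (supf_first_max Qx) t1 /ediv.
have [Sx|Sx] := pselect (Sinf (Theta x)).
  rewrite indicE memNset; last by move=> -[].
  by move: Sx; rewrite /Sinf /= SposE// => ->; rewrite mul0e.
rewrite indicE mem_set//=.
have := SS_ge 0 (Theta0 x); rewrite t1; move/(SinfN (Theta0 x)): Sx.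
case: (SS (Theta x)) => // r _; rewrite lee_fin => r1.
have r0 := lt_le_trans ltr01 r1.
by rewrite gt_eqF// mul1e -EFinM mulVf// gt_eqF.
Qed.

(** * When the extremal index equals one *)

Lemma ediv1_le1 (b : \bar R) : (1 <= b)%E -> (ediv 1 b <= 1)%E.
Proof.
case: b => [r| |]; [|by rewrite lee01|by rewrite leeNy_eq].
rewrite lee_fin /ediv => r1; have r0 := lt_le_trans ltr01 r1.
by rewrite gt_eqF// mul1e lee_fin invf_le1.
Qed.

Lemma ediv1_le_half (b : \bar R) : (2%:E <= b)%E -> (ediv 1 b <= (2^-1)%:E)%E.
Proof.
case: b => [r| |]; [|by move=> _; rewrite lee_fin invr_ge0|by rewrite leeNy_eq].
rewrite lee_fin /ediv => r2; have r0 : 0 < r by exact: lt_le_trans r2.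
by rewrite gt_eqF// mul1e lee_fin lef_pV2 ?posrE.
Qed.

Lemma BB_ge2 (f : Zd d -> R) (i : Zd d) : i != 0 -> 1 < f 0 -> 1 < f i ->
  (2%:E <= BB f)%E.
Proof.
move=> i0 f1 fi; pose a (j t : Zd d) : \bar R := if t == j then 1%E else 0%E.
have a0 j t : (0 <= a j t)%E by rewrite /a; case: ifP.
have aE j : \esum_(t in [set: Zd d]) a j t = 1%E.
  by rewrite (esum_unique (j := j))// /a ?eqxx// => t /negbTE ->.
have -> : 2%:E = (\esum_(t in [set: Zd d]) (a 0%R t + a i t))%E.
  by rewrite esumD// !aE -EFinD.
apply: le_esum => t _; rewrite /a.
have [->|t0] := eqVneq t 0; first by rewrite eq_sym (negbTE i0) adde0 f1.
by have [->|ti] := eqVneq t i; rewrite add0e ?fi// lee_fin; case: ifP.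
Qed.

Lemma measurable_ediv_BB : measurable_fun setT (fun w => ediv 1 (BB (Y w))).
Proof.
apply: measurable_ediv => //.
exact: (measurableT_comp (@measurable_BB R d) mY).
Qed.

(** If Y(i) > 1 for some i other than 0, then B >= 2, so 1/B plus half the indicator of Y(i) > 1 is
    at most 1. Mean 1 for 1/B thus forces P(Y(i) > 1) = 0. *)
Lemma EinvB_eq1 :
  EinvB = 1%E <-> forall i : Zd d, i != 0 -> {ae P, forall w, Theta w i = 0}.
Proof.
split => [E1 i i0|H]; last first.
  have {}H : {ae P, forall w, forall i, i != 0 -> Theta w i = 0}.
    apply: ae_countable => i; have [->|i0] := eqVneq i 0; first exact: filterE.
    by apply: filterS (H i i0) => w t0 _.
  rewrite -(probability_setT P) -[RHS]mul1e -(integral_cst P measurableT).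
  apply: ge0_ae_eq_integral => //.
  - exact: measurable_ediv_BB.
  - by move=> w _; rewrite ediv_ge0// BB_ge0.
  apply: filterS2 ae_normalized H => w [R1 t1] t0 _.
  have -> : BB (Y w) = 1%E.
    rewrite /BB (esum_unique (j := 0))//; first by rewrite /Ytail t1 mulr1 R1.
      by rewrite lee_fin; case: ifP.
    by move=> t tn0; rewrite /Ytail t0// mulr0 ltr10.
  by rewrite /ediv oner_eq0 invr1 mule1.
pose B := [set w | 1 < Y w i].
have mB : measurable B.
  by apply: (@measurable_Ypre [set f : E | 1 < (f i : R)]); exact: measurable_coord_gt.
have PB : P B = 0%E.
  have : (EinvB + (2^-1)%:E * P B <= 1)%E.
    rewrite -[in leLHS](setIT B) -integral_indic// -ge0_integralZl_EFin//; last first.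
      by apply/measurable_EFinP; exact: measurable_indic.
    have mBi : measurable_fun setT (fun w => ((2^-1)%:E * (\1_B w)%:E)%E : \bar R).
      by apply: emeasurable_funM => //; apply/measurable_EFinP; exact: measurable_indic.
    rewrite /EinvB -ge0_integralD//; last 2 first.
    - by move=> w _; rewrite ediv_ge0// BB_ge0.
    - exact: measurable_ediv_BB.
    rewrite -[leRHS](probability_setT P) -[leRHS]mul1e -(integral_cst P measurableT).
    apply: ae_ge0_le_integral => //.
    - by move=> w _; rewrite adde_ge0// ?ediv_ge0// ?BB_ge0// mule_ge0// lee_fin.
    - by apply: emeasurable_funD => //; exact: measurable_ediv_BB.
    apply: filterS ae_normalized => w [R1 t1] _.
    have Y0 : 1 < Y w 0 by rewrite /Ytail t1 mulr1.
    rewrite indicE; have [|_] := boolP (w \in B); last first.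
      by rewrite mule0 adde0; apply: ediv1_le1; exact: BB_ge1 Y0.
    rewrite inE => Bw; rewrite mule1.
    apply: (@le_trans _ _ ((2^-1)%:E + (2^-1)%:E)%E).
      by rewrite leeD2r//; apply: ediv1_le_half; exact: BB_ge2 i0 Y0 Bw.
    by rewrite -EFinD lee_fin [leRHS]splitr mul1r.
  have /fineK <- : P B \is a fin_num by exact: fin_num_measure.
  rewrite E1 -EFinM -EFinD lee_fin gerDl pmulr_rle0// => PB0.
  by congr EFin; apply/le_anti; rewrite PB0 fine_ge0.
(* This integral is P(Y(i) > 1), so a nonnegative function has integral 0 and vanishes almost
   everywhere. *)
have : (\int[P]_w `|(Num.min (Theta w i) 1)%:E| = 0)%E.
  rewrite -PB; have := prob_exceed i ler01.
  rewrite (_ : [set w | 1 < Rp w * (1 * Theta w i)] = B); last first.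
    by apply/seteqP; split => w; rewrite /B /= mul1r.
  move=> ->; apply: eq_integral => w _; rewrite mul1r gee0_abs//.
  by rewrite lee_fin le_min Theta0 ler01.
move/(ae_eq_integral_abs P measurableT) => H.
have {}H := H (ltac:(by apply/measurable_EFinP; apply: measurable_minr)).
apply: filterS H => w /(_ Logic.I) [] /eqP.
by rewrite /Num.min; case: ifP => _ /eqP// e; have := oner_neq0 R; rewrite e eqxx.
Qed.

End TailField.

(** * The extremal index as a first-exceedance probability *)

Section ExtremalIndex.
Context {R : realType} {d : nat} {dT : measure_display} {T : measurableType dT}.
Context (ord : rel (Zd d)) (ordP : ti_total_order ord).
Local Notation E := (fieldspace R d).
Context (P : probability T R) (Z : T -> Zd d -> R) (mu : probability E R).
Context (Z0 : forall w t, 0 <= Z w t).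
Context (mu_gt1 : {ae mu, forall f : E, 1 < (f 0 : R)}).
Context (Vfin : forall s, positive s -> Vexp P Z s \is a fin_num).
Context (Vrect : forall s, positive s ->
  mu (rect s) = (Vr P Z ((0, 1) :: s) - Vr P Z s)%:E).
Context (Vshift : forall h s, positive s -> Vr P Z (shift_seq h s) = Vr P Z s).

Definition unit_seq (s : seq (Zd d)) : seq (Zd d * R) := [seq (t, 1) | t <- s].

Lemma positive_unit s : positive (unit_seq s).
Proof. by move=> p /mapP[t _ ->] /=. Qed.

Definition Vone (s : seq (Zd d)) : R := Vr P Z (unit_seq s).

(** The field is viewed from [t], so site [u] appears at [u - t]; [~~ ord t u] says that [u]
    strictly precedes [t]. *)
Definition none_before (t : Zd d) (s : seq (Zd d)) : set E :=
  [set f | forall u, u \in s -> ~~ ord t u -> (f (u - t) : R) <= 1].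

Lemma none_before_rect t s : none_before t s =
  rect (shift_seq (- t) (unit_seq [seq u <- s | ~~ ord t u])).
Proof.
apply/seteqP; split => f H.
  move=> p /mapP[p' /mapP[u]]; rewrite mem_filter => /andP[ou us] -> -> /=.
  exact: H.
move=> u us ou; apply: (H (u - t, 1)); apply/mapP; exists (u, 1) => //.
by apply/mapP; exists u => //; rewrite mem_filter ou.
Qed.

Lemma measurable_none_before t s : measurable (none_before t s).
Proof. by rewrite none_before_rect; exact: measurable_rect. Qed.

Definition pnone (t : Zd d) (s : seq (Zd d)) : R := fine (mu (none_before t s)).

Lemma pnone_eq t s s' : [seq u <- s | ~~ ord t u] =i [seq u <- s' | ~~ ord t u] ->
  pnone t s = pnone t s'.
Proof.
move=> e; rewrite /pnone; congr (fine (mu _)); apply/seteqP; split => f H u us ou.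
  by have := e u; rewrite !mem_filter us ou => /andP[_ us']; exact: H.
by have := e u; rewrite !mem_filter us ou => /esym/andP[_ us']; exact: H.
Qed.

(** One step of the telescoping. All of [s] precedes [t]; translating both exponents by [- t] turns
    [Vone (t :: s) - Vone s] into the rectangle formula of [mu]. *)
Lemma Vone_cons t s : (forall u, u \in s -> ~~ ord t u) ->
  Vone (t :: s) = Vone s + pnone t (t :: s).
Proof.
move=> H.
have -> : pnone t (t :: s) = pnone t s.
  apply: pnone_eq => u; rewrite !mem_filter in_cons.
  by case: ordP => rf _ _ _ _; have [->|] := eqVneq u t; rewrite ?rf.
rewrite /pnone none_before_rect.
have -> : [seq u <- s | ~~ ord t u] = s by apply/all_filterP/allP.
rewrite Vrect; last exact: positive_shift (@positive_unit s).
have -> : (0, 1) :: shift_seq (- t) (unit_seq s) = shift_seq (- t) (unit_seq (t :: s)).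
  by rewrite /= subrr.
rewrite !Vshift; [|exact: positive_unit|exact: (@positive_unit (t :: s))].
by rewrite /= /Vone addrC subrK.
Qed.

(** The list decreases, so its head is the largest site: adding it leaves the events of the sites in
    the tail unchanged. *)
Lemma Vone_sorted s : sorted (fun x y => ord y x) s -> uniq s ->
  Vone s = \sum_(t <- s) pnone t s.
Proof.
case: (ordP) => rf anti tr tot _.
have trr : transitive (fun x y => ord y x) by move=> y x z xy yz; exact: tr yz xy.
elim: s => [_ _|t s IH].
  by rewrite big_nil /Vone /Vr /Vexp /mx; under eq_integral do rewrite big_nil; rewrite integral0.
move=> /= pt /andP[ts us].
have lt u : u \in s -> ord u t.
  by move=> us'; have /allP/(_ u us') := order_path_min trr pt.
have H u : u \in s -> ~~ ord t u.
  move=> us'; apply/negP => tu; move/negP: ts; apply.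
  by rewrite (anti t u)// tu lt.
rewrite Vone_cons// big_cons addrC; congr (_ + _).
rewrite IH//; last exact: path_sorted pt.
rewrite big_seq [RHS]big_seq; apply: eq_bigr => u us'; apply: pnone_eq => k.
rewrite !mem_filter in_cons; have [->|//] := eqVneq k t.
by rewrite (lt _ us') /=.
Qed.

Lemma Vone_sum s : uniq s -> Vone s = \sum_(t <- s) pnone t s.
Proof.
move=> us; case: (ordP) => _ _ tr tot _.
pose s' := sort (fun x y => ord y x) s.
have ps : perm_eq s' s by rewrite perm_sort.
have -> : Vone s = Vone s'.
  rewrite /Vone /Vr /Vexp; congr fine; apply: eq_integral => w _; congr EFin.
  by rewrite /mx !big_map; apply: perm_big; rewrite perm_sym.
rewrite Vone_sorted; last 2 first.
- by apply: sort_sorted => x y; exact: tot.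
- by rewrite sort_uniq.
rewrite (perm_big _ ps) /=; apply: eq_bigr => t _; apply: pnone_eq => u.
by rewrite !mem_filter mem_sort.
Qed.

Definition none_past : set E := [set f | forall k, ~~ ord 0 k -> (f k : R) <= 1].

Definition cube (m : nat) : set (Zd d) := [set k | forall i, `|k i| <= m%:Z].

Definition none_cube (m : nat) : set E :=
  [set f | forall k, cube m k -> ~~ ord 0 k -> (f k : R) <= 1].

Lemma measurable_none_past : measurable none_past.
Proof.
rewrite (_ : none_past = \bigcap_(k in [set k | ~~ ord 0 k]) [set f : E | f k <= 1]).
  by apply: measurable_bigcap_countable => k _; exact: measurable_coord_le.
by apply/seteqP; split => f H k; exact: H.
Qed.

Lemma measurable_none_cube m : measurable (none_cube m).
Proof.
rewrite (_ : none_cube m =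
    \bigcap_(k in [set k | cube m k /\ ~~ ord 0 k]) [set f : E | f k <= 1]).
  by apply: measurable_bigcap_countable => k _; exact: measurable_coord_le.
apply/seteqP; split => f H k; first by move=> [mk k0]; exact: H.
by move=> mk k0; exact: (H k (conj mk k0)).
Qed.

Definition q : R := fine (mu [set f | first_exceed ord f]).
Definition qcube m : R := fine (mu (none_cube m)).

Lemma mu_fin (A : set E) : measurable A -> mu A \is a fin_num.
Proof. exact: fin_num_measure. Qed.

Lemma le_fine_mu (A B : set E) : measurable A -> measurable B -> A `<=` B ->
  fine (mu A) <= fine (mu B).
Proof.
by move=> mA mB AB; apply: fine_le; rewrite ?mu_fin//; apply: le_measure; rewrite ?inE.
Qed.

Lemma fine_mu_le1 (A : set E) : measurable A -> fine (mu A) <= 1.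
Proof.
by move=> mA; rewrite -lee_fin fineK ?mu_fin//; exact: probability_le1.
Qed.

Lemma mu_first_exceed : mu [set f | first_exceed ord f] = mu none_past.
Proof.
apply: ae_eq_measure.
- exact: measurable_first_exceed.
- exact: measurable_none_past.
- apply: filterS mu_gt1 => f f1; split.
    by move=> [_ H] k k0; rewrite leNgt; apply: contra k0; exact: H.
  by move=> H; split=> // k fk; apply: contraLR fk => k0; rewrite -leNgt; exact: H.
Qed.

Lemma qcube_cvg : qcube m @[m --> \oo] --> q.
Proof.
apply: fine_cvg; rewrite fineK ?mu_fin//; last exact: measurable_first_exceed.
rewrite mu_first_exceed.
have capE : \bigcap_m none_cube m = none_past.
  apply/seteqP; split => f H; last by move=> m _ k _; exact: H.
  (* The sum of the absolute coordinates bounds each of them, so [k] lies in the cube of that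
     radius. *)
  move=> k k0; apply: (H (\sum_i `|k i|%N)%N) => // i.
  by rewrite -abszE lez_nat (bigD1 i)//= leq_addr.
rewrite -capE; apply: nonincreasing_cvg_mu.
- exact: le_lt_trans (probability_le1 mu (measurable_none_cube 0)) (ltry _).
- by move=> m; exact: measurable_none_cube.
- by rewrite capE; exact: measurable_none_past.
- move=> n m nm; apply/subsetPset => f H k nk; apply: H => i.
  by apply: le_trans (nk i) _; rewrite lez_nat.
Qed.

(** Translated by [- t], the constraints concern only some of the sites preceding the origin,
    whereas [none_past] constrains all of them. *)
Lemma pnone_ge t s : q <= pnone t s.
Proof.
rewrite /q mu_first_exceed; apply: le_fine_mu.
- exact: measurable_none_past.
- exact: measurable_none_before.
- by move=> f H u _ tu; apply: H; rewrite ord_sub.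
Qed.

Lemma pnone_le1 t s : pnone t s <= 1.
Proof. exact: fine_mu_le1 (measurable_none_before t s). Qed.

Lemma pnone_le_qcube t s m : (forall k, cube m k -> k + t \in s) ->
  pnone t s <= qcube m.
Proof.
move=> H; apply: le_fine_mu.
- exact: measurable_none_before.
- exact: measurable_none_cube.
- move=> f Hf k mk k0; have := Hf (k + t) (H k mk); rewrite addrK; apply.
  by rewrite -ord_sub// addrK.
Qed.

(** * Counting points in the box and passing to the limit *)

Definition boxpt n (g : {ffun 'I_d -> 'I_n.+1}) : Zd d := [ffun k => (g k : nat)%:Z].

Definition boxseq n : seq (Zd d) := [seq boxpt g | g : {ffun 'I_d -> 'I_n.+1}].

Lemma boxpt_inj n : injective (@boxpt n).
Proof.
move=> g h /ffunP gh; apply/ffunP => k; apply/val_inj.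
by have := gh k; rewrite !ffunE => -[].
Qed.

Lemma uniq_boxseq n : uniq (boxseq n).
Proof. by rewrite map_inj_uniq ?enum_uniq//; exact: boxpt_inj. Qed.

Lemma mem_boxseq n t : (t \in boxseq n) <-> @box d n t.
Proof.
split.
  move=> /mapP[g _ ->] k; rewrite ffunE; split=> //.
  by rewrite lez_nat -ltnS ltn_ord.
move=> bt; apply/mapP; exists [ffun k => inord `|t k|%N]; first by rewrite mem_enum.
apply/ffunP => k; rewrite !ffunE; have [t0 tn] := bt k.
rewrite inordK ?gez0_abs// ltnS.
by rewrite -lez_nat gez0_abs.
Qed.

Lemma ereal_sup_box n w :
  ereal_sup [set (Z w t)%:E | t in @box d n] = (mx (unit_seq (boxseq n)) (Z w))%:E.
Proof.
apply/le_anti/andP; split.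
  apply: ge_ereal_sup => _ [t /mem_boxseq tb <-]; rewrite lee_fin.
  elim: (boxseq n) tb => // u s IH; rewrite in_cons /= mx_cons /= divr1.
  by move=> /orP[/eqP ->|/IH ts]; rewrite le_max ?lexx// ts orbT.
have : {subset boxseq n <= boxseq n} by [].
elim: {1 3}(boxseq n) => [_|t s IH sub].
  rewrite /mx big_nil; apply: (@le_trans _ _ (Z w 0)%:E); first by rewrite lee_fin.
  by apply: ereal_sup_ubound; exists 0 => // k; rewrite ffunE.
rewrite /= mx_cons /= divr1 EFin_max ge_max; apply/andP; split.
  by apply: ereal_sup_ubound; exists t => //; apply/mem_boxseq/sub; rewrite mem_head.
by apply: IH => u us; apply: sub; rewrite in_cons us orbT.
Qed.

Lemma integral_sup_box n :
  (\int[P]_w ereal_sup [set (Z w t)%:E | t in @box d n] = (Vone (boxseq n))%:E)%E.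
Proof.
rewrite /Vone /Vr fineK; last exact/Vfin/positive_unit.
by apply: eq_integral => w _; exact: ereal_sup_box.
Qed.

Definition box_interior m n (g : {ffun 'I_d -> 'I_n.+1}) :=
  [forall k, (m <= g k)%N && (g k + m <= n)%N].

Lemma interior_cube m n g k : @box_interior m n g -> cube m k ->
  k + boxpt g \in boxseq n.
Proof.
move=> /forallP ig mk; apply/mem_boxseq => i; rewrite !ffunE.
have /andP[h1 h2] := ig i; have := mk i; rewrite ler_norml => /andP[h3 h4].
by move: (nat_of_ord (g i)) (k i) h1 h2 h3 h4 => b a h1 h2 h3 h4; split; lia.
Qed.

(** Along each coordinate, translation by [m] injects n + 1 - 2m indices into the admissible ones;
    the subtraction is truncated, so small [n] gives a trivial bound for positive [d]. *)
Lemma card_interior m n :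
  ((n.+1 - m.*2) ^ d <= #|[pred g | @box_interior m n g]|)%N.
Proof.
pose A := [pred j : 'I_n.+1 | (m <= j)%N && (j + m <= n)%N].
have cA : (n.+1 - m.*2 <= #|A|)%N.
  pose h (i : 'I_(n.+1 - m.*2)) : 'I_n.+1 := inord (i + m)%N.
  have hE i : h i = (i + m)%N :> nat.
    by rewrite inordK//; have := ltn_ord i; lia.
  have hinj : injective h.
    move=> i j /(congr1 (@nat_of_ord _)); rewrite !hE => /addIn.
    exact: val_inj.
  rewrite -[leqLHS]card_ord -(card_codom hinj); apply: subset_leq_card.
  apply/fintype.subsetP => _ /codomP[i ->]; rewrite inE hE.
  by have := ltn_ord i; lia.
apply: (@leq_trans (#|A| ^ d)%N).
  by case: (posnP d) => [->|d0]; rewrite ?expn0// leq_exp2r.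
rewrite -[X in (_ ^ X)%N](card_ord d) -card_ffun_on; apply: subset_leq_card.
apply/fintype.subsetP => g /ffun_onP gA; rewrite inE; apply/forallP => k.
exact: gA.
Qed.

Lemma Vone_box_ge n : n.+1%:R ^+ d * q <= Vone (boxseq n).
Proof.
rewrite Vone_sum ?uniq_boxseq// big_map big_enum /=.
rewrite -natrX -[X in (X ^ _)%N](card_ord n.+1) -[X in (_ ^ X)%N](card_ord d).
rewrite -card_ffun mulr_natl -sumr_const.
by apply: ler_sum => g _; exact: pnone_ge.
Qed.

Lemma Vone_box_le m n : Vone (boxseq n) <=
  n.+1%:R ^+ d * qcube m + (n.+1%:R ^+ d - (n.+1 - m.*2)%:R ^+ d).
Proof.
rewrite Vone_sum ?uniq_boxseq// big_map big_enum /=.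
(* An interior site contributes at most [qcube m], and a boundary site at most 1, which the added
   complement of the interior indicator covers. *)
apply: (@le_trans _ _ (\sum_(g : {ffun 'I_d -> 'I_n.+1})
    (qcube m + (1 - (@box_interior m n g)%:R)))).
  apply: ler_sum => g _; have [ig|ig] := boolP (box_interior m g).
    rewrite subrr addr0; apply: pnone_le_qcube => k mk.
    exact: interior_cube ig mk.
  by rewrite subr0; apply: le_trans (pnone_le1 _ _) _; rewrite lerDr fine_ge0.
rewrite big_split /= sumrB !sumr_const card_ffun !card_ord -natrX mulr_natl.
rewrite lerD2l natrX lerD2l lerN2 -natr_sum -natrX ler_nat.
apply: leq_trans (card_interior m n) _.
by rewrite -sum1_card big_mkcond /=; apply: leq_sum => g _; rewrite inE; case: box_interior.
Qed.

(** The box has n + 1 points per side and its interior n + 1 - 2m, while the normalisation is n^d;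
    the constant [c] covers both counts. *)
Lemma ratio_cvg (c : R) : ((n%:R + c) / n%:R) ^+ d @[n --> \oo] --> (1 : R).
Proof.
have inv0 : (n%:R : R)^-1 @[n --> \oo] --> (0 : R).
  apply/gtr0_cvgV0; last exact: cvgr_idn.
  by near=> n; rewrite ltr0n; near: n; exact: nbhs_infty_gt.
have h : 1 + c * (n%:R)^-1 @[n --> \oo] --> (1 : R).
  rewrite -[X in _ --> X]addr0 -[X in _ --> _ + X](mulr0 c).
  by apply: cvgD; [exact: cvg_cst|apply: cvgM => //; exact: cvg_cst].
rewrite -[X in _ --> X](expr1n _ d).
have h2 : (1 + c * n%:R^-1) ^+ d @[n --> \oo] --> (1 : R) ^+ d.
  exact: (cvg_comp (fun n : nat => 1 + c * n%:R^-1) (fun x : R => x ^+ d) h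
    (@exprn_continuous R d 1)).
apply: cvg_trans h2; apply: near_eq_cvg; near=> n.
rewrite mulrDl divff//.
rewrite pnatr_eq0 -lt0n; near: n; exact: nbhs_infty_gt.
Unshelve. all: by end_near.
Qed.

(** A squeeze: the lower bound tends to [q], and for each [m] the upper bound tends to [qcube m],
    itself close to [q] for suitable [m]. *)
Lemma extremal_index_first_exceed :
  extremal_index_is P Z (mu [set f | first_exceed ord f]).
Proof.
rewrite /extremal_index_is.
have mfe : measurable [set f : E | first_exceed ord f] by exact: measurable_first_exceed.
rewrite -(fineK (mu_fin mfe)) -/q.
under eq_fun do rewrite integral_sup_box -EFinM.
apply: cvg_EFin; first by near=> n.
have cge : ((n%:R + 1) / n%:R) ^+ d * q @[n --> \oo] --> q.
  by rewrite -[X in _ --> X]mul1r; apply: cvgM; [exact: ratio_cvg|exact: cvg_cst].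
pose up m (n : nat) : R := ((n%:R + 1) / n%:R) ^+ d * qcube m +
  (((n%:R + 1) / n%:R) ^+ d - ((n%:R + (1 - m.*2%:R)) / n%:R) ^+ d).
have cup m : up m n @[n --> \oo] --> qcube m.
  rewrite -[X in _ --> X]addr0 -[X in _ --> X + _]mul1r -[X in _ --> _ + X](subrr 1).
  apply: cvgD; last by apply: cvgB; exact: ratio_cvg.
  by apply: cvgM; [exact: ratio_cvg|exact: cvg_cst].
apply/cvgrPdist_le => e e0.
(* One half of [e] pays for replacing [q] by [qcube m], the other for the convergence of the upper
   bound with [m] fixed. *)
have e2 : 0 < e / 2 by rewrite divr_gt0.
have [m qm] : exists m, qcube m <= q + e / 2.
  have /cvgrPdist_le/(_ _ e2)[m _ /(_ m (leqnn m)) /=] := qcube_cvg.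
  by rewrite distrC => /ler_distlDr ?; exists m.
have /cvgrPdist_le/(_ _ e0) lo := cge.
have /cvgrPdist_le/(_ _ e2) hi := cup m.
near=> n.
have n0 : (0 < n)%N by near: n; exact: nbhs_infty_gt.
(* For such [n] the truncated subtraction in the interior count is a genuine difference. *)
have nm : (m.*2 <= n)%N by near: n; exact: nbhs_infty_ge.
have nR : 0 < (n%:R ^+ d : R) by rewrite exprn_gt0// ltr0n.
have hlo : ((n%:R + 1) / n%:R) ^+ d * q <= n%:R ^- d * Vone (boxseq n).
  rewrite expr_div_n mulrAC [leRHS]mulrC ler_pM2r ?invr_gt0// natr1.
  exact: Vone_box_ge.
have hhi : n%:R ^- d * Vone (boxseq n) <= up m n.
  rewrite /up !expr_div_n mulrAC -mulrBl -mulrDl [leLHS]mulrC ler_pM2r ?invr_gt0//.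
  have eS : n.+1%:R = n%:R + 1 :> R by rewrite natr1.
  have eB : (n.+1 - m.*2)%:R = n%:R + (1 - m.*2%:R) :> R.
    by rewrite natrB ?(leqW nm)// eS addrA.
  by have := Vone_box_le m n; rewrite eB eS.
rewrite /=.
have l1 : `|q - ((n%:R + 1) / n%:R) ^+ d * q| <= e by near: n.
have l2 : `|qcube m - up m n| <= e / 2 by near: n.
move: l1 l2; rewrite !ler_norml => /andP[l11 l12] /andP[l21 l22].
apply/andP; split; lra.
Unshelve. all: by end_near.
Qed.

End ExtremalIndex.

Theorem theorem3p4 (R : realType) (d : nat) (ord : rel (Zd d))
  (d1 d2 d3 : measure_display)
  (T1 : measurableType d1) (T2 : measurableType d2) (T3 : measurableType d3)
  (P1 : probability T1 R) (P2 : probability T2 R) (P3 : probability T3 R)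
  (X : T1 -> Zd d -> R) (Z : T2 -> Zd d -> R)
  (Theta : T3 -> Zd d -> R) (Rp : T3 -> R)
  (I : (Zd d -> R) -> option (Zd d)) :
  (* the fixed translation-invariant total order on Z^d *)
  ti_total_order ord ->
  (* X is a random field on (T1, P1) *)
  (forall t, measurable_fun setT (fun w => X w t)) ->
  (* X is stationary *)
  (forall (h : Zd d) (A : set (Zd d -> R)), prodF A ->
     P1 [set w | A (X w)] = P1 [set w | A (Bshift h (X w))]) ->
  (* Z is a spectral random field on (T2, P2) *)
  (forall t, measurable_fun setT (fun w => Z w t)) ->
  (forall w t, 0 <= Z w t) ->
  (forall t, (\int[P2]_w (Z w t)%:E = 1)%E) ->
  P2 [set w | (0 < supf (Z w))%E] = 1%E ->
  (* X is max-stable with spectral random field Z *)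
  (forall (n : nat) (t : 'I_n -> Zd d) (x : 'I_n -> R), (forall i, 0 < x i) ->
     (- ln (fine (P1 [set w | forall i, X w (t i) <= x i])))%:E
       = (\int[P2]_w (\big[Num.max/0]_(i < n) (Z w (t i) / x i))%:E)%E) ->
  (* Theta (on (T3, P3)) is the spectral tail random field *)
  (forall t, measurable_fun setT (fun w => Theta w t)) ->
  (forall w t, 0 <= Theta w t) ->
  (forall A : set (Zd d -> R), prodF A ->
     P3 [set w | A (Theta w)]
       = (\int[P2]_w (Z w 0 * \1_A (fun t => Z w t / Z w 0))%:E)%E) ->
  (* Rp is unit Pareto, independent of Theta *)
  measurable_fun setT Rp ->
  (forall x : R, 1 <= x -> P3 [set w | x < Rp w] = (x^-1)%:E) ->
  (forall (B : set R) (A : set (Zd d -> R)), measurable B -> prodF A ->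
     P3 [set w | B (Rp w) /\ A (Theta w)]
       = (P3 [set w | B (Rp w)] * P3 [set w | A (Theta w)])%E) ->
  (* I is an anchoring map with P(I(Y) in Z^d, S(Y) < oo) = P(S(Y) < oo) *)
  anchoring I ->
  let Y := fun w t => Rp w * Theta w t in
  P3 [set w | I (Y w) <> None /\ (SS (Y w) < +oo)%E]
    = P3 [set w | (SS (Y w) < +oo)%E] ->
  let EinvB := (\int[P3]_w ediv 1 (BB (Y w)))%E in
  (* theta_X = E[1/B(Y)] holds in general *)
  extremal_index_is P2 Z EinvB /\
  ((0 < P3 [set w | (SS (Theta w) < +oo)%E])%E ->
     extremal_index_is P2 Z (P3 [set w | I (Y w) = Some 0 /\ (SS (Y w) < +oo)%E]) /\
     P3 [set w | I (Y w) = Some 0 /\ (SS (Y w) < +oo)%E]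
       = P3 [set w | I_fe ord (Y w) = Some 0] /\
     P3 [set w | I_fe ord (Y w) = Some 0]
       = P3 [set w | I_A ord (Theta w) = Some 0] /\
     P3 [set w | I_A ord (Theta w) = Some 0]
       = (\int[P3]_w ediv (supf (Theta w)) (SS (Theta w)))%E /\
     (\int[P3]_w ediv (supf (Theta w)) (SS (Theta w)))%E
       = (\int[P2]_w ((Z w 0)%:E * ediv (supf (Z w)) (SS (Z w))))%E /\
     (\int[P2]_w ((Z w 0)%:E * ediv (supf (Z w)) (SS (Z w))))%E = EinvB /\
     (zero_homogeneous I ->
        extremal_index_is P2 Z
          (P3 [set w | I (Theta w) = Some 0 /\ (SS (Theta w) < +oo)%E]))) /\
  P3.-negligible [set w | ~ ((BB (Y w) < +oo)%E <-> (SS (Y w) < +oo)%E)] /\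
  (extremal_index_is P2 Z 1%E <->
     forall i : Zd d, i != 0 -> {ae P3, forall w, Theta w i = 0}).
Proof.
move=> ordP _ Xstat mZ Z0 EZ _ XZ mTheta Theta0 ThetaZ mRp pareto indep anchI Y.
move=> I_defined EinvBY.
have Theta1 := Theta_at0 EZ mTheta ThetaZ.
have tc := lawY_time_change Xstat mZ Z0 EZ XZ mTheta Theta0 ThetaZ mRp pareto indep.
have EI : extremal_index_is P2 Z EinvBY.
  rewrite -[EinvBY](lawY_first_exceed ordP Theta0 pareto indep Theta1 tc).
  apply: (extremal_index_first_exceed ordP Z0).
  - exact: lawY_gt1.
  - by move=> s s0; exact: (Vexp_fin_num XZ).
  - by move=> s s0; exact: (Y_rect mZ Z0 EZ XZ mTheta Theta0 ThetaZ mRp).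
  - by move=> h s s0; exact: (Vr_shift Xstat XZ).
have pI : P3 [set w | I (Y w) = Some 0 /\ (SS (Y w) < +oo)%E] = EinvBY.
  exact: (prob_I ordP Theta0 pareto indep Theta1 tc anchI I_defined).
have pfe : P3 [set w | I_fe ord (Y w) = Some 0] = EinvBY.
  exact: (prob_I_fe ordP Theta0 pareto indep Theta1 tc).
have pA : P3 [set w | I_A ord (Theta w) = Some 0] = EinvBY.
  exact: (prob_I_A ordP Theta0 pareto indep Theta1 tc).
have pS : (\int[P3]_w ediv (supf (Theta w)) (SS (Theta w)))%E = EinvBY.
  exact: (expect_sup_over_sum ordP Theta0 pareto indep Theta1 tc).
have pZ := integral_Theta_sup_over_sum mZ Z0 mTheta Theta0 ThetaZ.
split; first exact: EI.
split; last split.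
- move=> _; rewrite -pZ pS pI pfe pA; do ?split => //; move=> hom.
  by rewrite (prob_I_Theta ordP Theta0 pareto indep Theta1 tc anchI I_defined hom).
- exact: (BB_SS_negligible ordP Theta0 pareto indep Theta1 tc).
(* The limit defining the extremal index is unique, so an index of 1 means that E[1/B(Y)] equals
   1. *)
- rewrite -(EinvB_eq1 mTheta Theta0 mRp pareto indep Theta1); split => E1.
    exact: (cvg_unique _ EI E1).
  by rewrite -E1.
Qed.
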